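(* There is an absolute constant $C>0$ such that the following holds. Let $D \ge 1$ be an integer and let $G$ be a $D$-degenerate graph with $n \ge 2$ vertices and $k \geq n$ edges. Then there is a positive integer $m$ with $m^3 \le C\, D\, k \log n$ such that $G$ has a grid-drawing in $[m]^3$.
   Context: For a positive integer $m$, $[m]=\{0,1,\ldots,m-1\}$. A grid-drawing of a graph $G$ in $[m]^3$ is a representation of $G$ in which the vertices are mapped to distinct points of $[m]^3\subseteq\mathbb{Z}^3$ and each edge is drawn as the straight-line segment between the images of its endpoints, such that (i) no edge's segment contains the image of a vertex not incident to that edge, and (ii) no two edges' segments share a common interior point. The degeneracy of a graph is the smallest positive integer $D$ such that every subgraph has a vertex of degree at most $D$; a graph is $D$-degenerate if its degeneracy is at most $D$. The statement in the paper is written as: there is a grid-drawing of $G$ in $[m]^3$ where $m^3 = O(Dk\log n)$. *)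

(* Defs.v *)
From mathcomp Require Import all_classical all_reals all_analysis.
From mathcomp Require Import all_boot all_order all_algebra.
Set Implicit Arguments.
Unset Strict Implicit.
Unset Printing Implicit Defensive.
Import Order.TTheory GRing.Theory Num.Theory.

Local Open Scope ring_scope.

(* A finite simple graph is a symmetric irreflexive relation e on a finType;
   its edges are the unordered pairs [set x; y] with e x y. *)
Definition edge_set (T : finType) (e : rel T) : {set {set T}} :=
  [set [set p.1; p.2] | p : T * T & e p.1 p.2].

(* Subgraphs are neither assumed induced nor spanning. *)
Definition subgraph (T : finType) (e : rel T)
    (S : {set T}) (F : {set {set T}}) : bool :=
  (F \subset edge_set e) && [forall f in F, f \subset S].

Definition degree_in (T : finType) (F : {set {set T}}) (x : T) : nat :=
  #|[set f in F | x \in f]|.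

(* The null graph (S = set0) is excluded, having no vertex at all. *)
Definition low_degree_subgraphs (T : finType) (e : rel T) (D : nat) : bool :=
  [forall S : {set T}, forall F : {set {set T}},
     (S != set0) && subgraph e S F ==>
       [exists x in S, (degree_in F x <= D)%N]].

Lemma degeneracy_subproof (T : finType) (e : rel T) :
  exists D, (0 < D)%N && low_degree_subgraphs e D.
Proof.
exists #|edge_set e|.+1; apply/forallP => S; apply/forallP => F.
apply/implyP => /andP[/set0Pn[x xS] /andP[FE _]].
apply/existsP; exists x; rewrite xS /=.
apply/leqW/subset_leq_card/(subset_trans _ FE).
by apply/subsetP => f; rewrite inE => /andP[].
Qed.

Definition degeneracy (T : finType) (e : rel T) : nat :=
  ex_minn (degeneracy_subproof e).

Definition degenerate (D : nat) (T : finType) (e : rel T) : bool :=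
  (degeneracy e <= D)%N.

Definition grid_point (R : realType) (m : nat) (a : 'rV['I_m]_3) : 'rV[R]_3 :=
  \row_j (a 0 j : nat)%:R.

Definition segment (R : realType) (x y : 'rV[R]_3) : set 'rV[R]_3 :=
  [set (1 - t) *: x + t *: y | t in `[0, 1]]%classic.

(* The relative interior of [segment x y] when x != y. *)
Definition open_segment (R : realType) (x y : 'rV[R]_3) : set 'rV[R]_3 :=
  [set (1 - t) *: x + t *: y | t in `]0, 1[]%classic.

Definition grid_drawing (R : realType) (T : finType) (e : rel T) (m : nat)
    (p : T -> 'rV['I_m]_3) : Prop :=
  let q v := grid_point R (p v) in
  [/\ injective p,
      forall u v w : T, e u v -> w \notin [set u; v] ->
        ~ segment (q u) (q v) (q w)
    & forall u v w x : T, e u v -> e w x -> [set u; v] != [set w; x] ->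
        ~ (exists z, open_segment (q u) (q v) z /\
                     open_segment (q w) (q x) z)].

(* Main.v *)
(** Fix a grid with M = m^3 points. Quadruples of grid points are rarely
    coplanar: for every point a, at most N = O(m^6 log m) triples (b, c, d) are
    coplanar with a. Indeed three dependent integer vectors of norm at most m
    lie in a lattice Z e1 + Z e2 with a Gauss-reduced basis, and summing the
    number of possible coefficients over all reduced pairs gives a harmonic sum.

    Once M^3 >= C D k N, a placement in which no two disjoint edges are coplanar
    is found by minimising a potential over partial placements (A, f). Each
    vertex v has a weight w v, and one endpoint of every edge is designated as
    expendable so that the edges at r endanger weight at most 3 D (w r). The
    potential is the weight of the unplaced vertices plus, for each placed
    vertex, a multiple of its "load": the number of grid points that edges
    already drawn forbid to its future neighbours, and the expected increments
    of that number. If r is unplaced, put it at a uniformly random grid point,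
    then unplace the expendable endpoint of every new edge coplanar with an old
    one and every overloaded vertex. On average the potential gains less than
    the w r it has lost, so a minimiser has placed every vertex. *)

Require Import Defs.
From mathcomp Require Import all_classical all_reals all_analysis.
From mathcomp Require Import all_boot all_order all_algebra.
From mathcomp Require Import ring lra zify.
Import Order.TTheory GRing.Theory Num.Theory.
Local Open Scope ring_scope.

Set Implicit Arguments.
Unset Strict Implicit.
Unset Printing Implicit Defensive.

(** * Vertex weights adapted to a degeneracy order *)

(* [w] solves, up to constants, [w v = w0 v + (1 / 2D) * \sum w z] over the later
   neighbours [z] of [v] in a degeneracy order, and [t r u] is the later of [r]
   and [u]. Both are built by removing the last vertex [x], whose weight is
   distributed over the [w0] of its at most [D] earlier neighbours. *)
Lemma degenerate_weights_in (R : realFieldType) (T : finType) (e : rel T) (D : nat) :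
  (0 < D)%N -> symmetric e -> irreflexive e ->
  (forall S : {set T}, S != set0 ->
     exists2 x, x \in S & (#|[set y in S | e x y]| <= D)%N) ->
  forall (S : {set T}) (w0 : T -> R), {in S, forall v, 0 <= w0 v} ->
  exists (w : T -> R) (t : T -> T -> T),
    [/\ {in S, forall v, w0 v <= w v},
        forall r u, t r u = r \/ t r u = u,
        {in S, forall r, \sum_(u in S | e r u) w (t r u)
                           <= 3 * D%:R * w r - 2 * D%:R * w0 r}
      & \sum_(v in S) w v <= 2 * \sum_(v in S) w0 v].
Proof.
move=> D0 esym eirr hdeg S.
have D0R : 0 < D%:R :> R by rewrite ltr0n.
have [k leSk] := ubnP #|S|; elim: k S leSk => // k IHk S leSk w0 w0_ge0.
have [->|Sn0] := eqVneq S set0.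
  exists w0, (fun r _ => r); split=> [v||v|]; rewrite ?inE //; first by left.
  by rewrite !big_set0 mulr0.
have [x xS degx] := hdeg S Sn0.
have ltSk : (#|S :\ x| < k)%N by move: leSk; rewrite (cardsD1 x) xS.
(* For a neighbour [r] of [x], the term [- 2 D (w1 r)] of the induction hypothesis is smaller by
   exactly [w0 x] than [- 2 D (w0 r)], which pays for the edge from [r] to [x]. The at most [D]
   neighbours gain at most [w0 x / 2] in all, so the total stays below twice that of [w0]. *)
pose w1 u := w0 u + (e u x)%:R * (w0 x / (2 * D%:R)).
have w0x : 0 <= w0 x by exact: w0_ge0.
have w1_ge0 : {in S :\ x, forall v, 0 <= w1 v}.
  move=> v /setD1P[_ vS]; rewrite addr_ge0 ?w0_ge0 // mulr_ge0 ?ler0n //.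
  by rewrite divr_ge0 // mulr_ge0 ?ler0n.
have [w [t [ww tt sumt sumw]]] := IHk _ ltSk _ w1_ge0.
pose w' v := if v == x then w0 x else w v.
pose t' r u := if (r == x) || (u == x) then x else t r u.
exists w', t'; split.
- move=> v vS; rewrite /w'; case: eqVneq => [->//|vx].
  have /ww : v \in S :\ x by rewrite !inE vx.
  apply: le_trans; rewrite lerDl mulr_ge0 ?ler0n // divr_ge0 // mulr_ge0 ?ler0n //.
- move=> r u; rewrite /t'; case: eqVneq => [->|_] /=; first by left.
  by case: eqVneq => [->|_]; [right|exact: tt].
- move=> r rS; have [->|rx] := eqVneq r x.
    (* Every edge at [x] designates [x], so the sum is at most
       [D (w0 x) = 3 D (w0 x) - 2 D (w0 x)]. *)
    rewrite (eq_bigr (fun=> w0 x)); last by move=> u _; rewrite /t' /w' !eqxx.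
    rewrite sumr_const /w' eqxx -[_ *+ _]mulr_natl.
    have : (#|[pred u | u \in S & e x u]|%:R : R) <= D%:R.
      by rewrite ler_nat; apply: leq_trans degx; rewrite cardsE.
    move=> /(ler_wpM2r w0x) h; apply: le_trans h _; lra.
  have rSx : r \in S :\ x by rewrite !inE rx.
  have -> : \sum_(u in S | e r u) w' (t' r u) =
     (e r x)%:R * w0 x + \sum_(u in S :\ x | e r u) w (t r u).
    rewrite big_mkcondr (big_setD1 x) //= -big_mkcondr /=.
    congr (_ + _); first by case: (e r x); rewrite ?mul0r // mul1r /w' /t' eqxx orbT eqxx.
    apply: eq_bigr => u /andP[/setD1P[ux uS] _].
    rewrite /w' /t' (negPf rx) (negPf ux) /=.
    by case: (tt r u) => ->; rewrite ?(negPf rx) ?(negPf ux).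
  have := sumt r rSx; rewrite /w' (negPf rx) /w1.
  have -> : 2 * D%:R * (w0 r + (e r x)%:R * (w0 x / (2 * D%:R)))
     = 2 * D%:R * w0 r + (e r x)%:R * w0 x.
    by field; rewrite lt0r_neq0.
  by move=> h; lra.
- rewrite (big_setD1 x) //= [X in _ <= 2 * X](big_setD1 x) //=.
  have -> : \sum_(v in S :\ x) w' v = \sum_(v in S :\ x) w v.
    by apply: eq_bigr => v /setD1P[vx _]; rewrite /w' (negPf vx).
  rewrite {1}/w' eqxx.
  have : \sum_(v in S :\ x) w1 v <= \sum_(v in S :\ x) w0 v + w0 x / 2.
    rewrite big_split /= lerD2l -mulr_suml.
    have -> : \sum_(v in S :\ x) (e v x)%:R = #|[set v in S :\ x | e v x]|%:R :> R.
      rewrite -sum1_card natr_sum big_mkcond [RHS]big_mkcond /=.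
      by apply: eq_bigr => v _; rewrite !inE; case: ifP => //= _; case: (e v x).
    have : (#|[set v in S :\ x | e v x]|%:R : R) <= D%:R.
      rewrite ler_nat; apply: leq_trans degx; apply/subset_leq_card/fintype.subsetP=> v.
      by rewrite !inE esym => /andP[/andP[_ ->] ->].
    have h0 : 0 <= w0 x / (2 * D%:R) by rewrite divr_ge0 // mulr_ge0 ?ler0n.
    move=> /(ler_wpM2r h0) /le_trans; apply.
    by rewrite le_eqVlt; apply/orP; left; apply/eqP; field; rewrite lt0r_neq0.
  lra.
Qed.

Lemma degenerate_weights (R : realFieldType) (T : finType) (e : rel T) (D : nat)
    (w0 : T -> R) :
  (0 < D)%N -> symmetric e -> irreflexive e ->
  (forall S : {set T}, S != set0 ->
     exists2 x, x \in S & (#|[set y in S | e x y]| <= D)%N) ->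
  (forall v, 0 <= w0 v) ->
  exists (w : T -> R) (t : T -> T -> T),
    [/\ forall v, w0 v <= w v,
        forall r u, t r u = r \/ t r u = u,
        forall r, \sum_(u | e r u) w (t r u) <= 3 * D%:R * w r
      & \sum_v w v <= 2 * \sum_v w0 v].
Proof.
move=> D0 esym eirr hdeg w0_ge0.
have := @degenerate_weights_in R T e D D0 esym eirr hdeg [set: T] w0.
case=> [v _|w [t [ww tt sumt sumw]]]; first exact: w0_ge0.
exists w, t; split=> //.
- by move=> v; apply: ww; rewrite inE.
- move=> r; have := sumt r (finset.in_setT r).
  under eq_bigl do rewrite inE /=.
  move=> /le_trans; apply; have := w0_ge0 r; have : 0 <= D%:R :> R by [].
  move=> a b; have := mulr_ge0 a b; lra.
- by move: sumw; under eq_bigl do rewrite inE; under [X in 2 * X]eq_bigl do rewrite inE.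
Qed.

(** * The potential argument *)

Section Placement.
Variables (R : realFieldType) (P T : finType) (cop : P -> P -> P -> P -> bool).
Hypothesis cop12 : forall a b c d, cop b a c d = cop a b c d.
Hypothesis cop23 : forall a b c d, cop a c b d = cop a b c d.
Hypothesis cop34 : forall a b c d, cop a b d c = cop a b c d.

Definition plane_size (a b c : P) : R := \sum_d (cop a b c d)%:R.
Definition pencil_size (a b : P) : R := \sum_c plane_size a b c.

Local Notation pl := plane_size.
Local Notation pn := pencil_size.

Lemma plane_size_ge0 a b c : 0 <= pl a b c.
Proof. by apply: sumr_ge0 => d _; rewrite ler0n. Qed.

Lemma pencil_size_ge0 a b : 0 <= pn a b.
Proof. by apply: sumr_ge0 => d _; exact: plane_size_ge0. Qed.

Lemma plane_size12 a b c : pl b a c = pl a b c.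
Proof. by apply: eq_bigr => d _; rewrite cop12. Qed.

Lemma plane_size23 a b c : pl a c b = pl a b c.
Proof. by apply: eq_bigr => d _; rewrite cop23. Qed.

Lemma pencil_sizeC a b : pn a b = pn b a.
Proof. by apply: eq_bigr => c _; rewrite plane_size12. Qed.

Lemma sum_plane_size a b : \sum_p pl p a b = pn a b.
Proof. by apply: eq_bigr => c _; rewrite plane_size12 plane_size23. Qed.

(** In the application [K] is the sum of all degrees, so that the lower bounds [deg v * n / K] on
    the weights sum to [n], and [N] bounds the number of triples coplanar with a given point. *)
Variables (e : rel T) (D : nat) (N K : R) (w : T -> R) (t : T -> T -> T).
Hypothesis esym : symmetric e.
Hypothesis eirr : irreflexive e.
Local Notation M := (#|P|%:R : R).
Local Notation n := (#|T|%:R : R).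
Local Notation deg r := (\sum_u (e r u)%:R : R).
Hypothesis D_gt0 : (0 < D)%N.
Hypothesis pencil_sum : forall a, \sum_b pn a b <= N.
Hypothesis N_gt0 : 0 < N.
Hypothesis M_gt0 : 0 < M.
Hypothesis K_ge : n <= K.
Hypothesis n_gt0 : 0 < n.
Hypothesis M_big : 32%:R ^+ 3 * D%:R * K * N <= M ^+ 3.
Hypothesis w_ge1 : forall v, 1 <= w v.
Hypothesis w_deg : forall v, deg v * n / K <= w v.
Hypothesis tE : forall r u, t r u = r \/ t r u = u.
Hypothesis w_t : forall r, \sum_(u | e r u) w (t r u) <= 3 * D%:R * w r.
Hypothesis w_sum : \sum_v w v <= 4 * n.

(** The three constants make three of the expected losses at most [w r / 8]: [T1] for the crossings,
    [T2] for the growth of the vertex loads, and [kap] for the growth of the total load. *)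
Let T1 : R := M / (24 * D%:R).
Let T2 : R := 64 * n * N / M.
Let kap : R := n * M / (16 * K * N).

Let K_gt0 : 0 < K. Proof. exact: lt_le_trans K_ge. Qed.
Let D_gt0R : 0 < D%:R :> R. Proof. by rewrite ltr0n. Qed.
Let T1_gt0 : 0 < T1. Proof. by rewrite divr_gt0 // mulr_gt0. Qed.
Let T2_gt0 : 0 < T2. Proof. by rewrite divr_gt0 // !mulr_gt0. Qed.
Let kap_gt0 : 0 < kap. Proof. by rewrite divr_gt0 // !mulr_gt0. Qed.
Let w_gt0 v : 0 < w v. Proof. exact: lt_le_trans (w_ge1 v). Qed.
Let w_ge0 v : 0 <= w v. Proof. exact: ltW. Qed.

Definition edge_load (A : {set T}) (f : T -> P) (u : T) : R :=
  \sum_(x in A) \sum_(y in A)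
    ([&& x != u, y != u & e x y])%:R * pl (f u) (f x) (f y).

Definition vertex_load (A : {set T}) (f : T -> P) (x : T) : R :=
  \sum_(u in A) (u != x)%:R * w u * pn (f u) (f x).

Definition total_load (A : {set T}) (f : T -> P) : R :=
  \sum_(x in A) \sum_(y in A) (e x y)%:R * pn (f x) (f y).

(* [edge_load] bounds the points forbidden to neighbours of [u],
   [vertex_load] controls the expected growth of the edge loads of the other
   vertices when a neighbour of [x] is placed, and [total_load] the expected edge
   load of a new vertex. *)
Definition potential (A : {set T}) (f : T -> P) : R :=
  \sum_(v in ~: A) w v + \sum_(u in A) w u * edge_load A f u / T1
  + \sum_(x in A) w x * vertex_load A f x / T2 + kap * total_load A f.

(** Stronger than the absence of crossings: two disjoint edges may not even be coplanar. The
    arguments of [cop] are ordered as in [edge_load], so that [f v] is a point forbidden to the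
    neighbours of [u] by the edge [xy]. *)
Definition crossing_free (A : {set T}) (f : T -> P) : bool :=
  [forall u in A, forall v in A, forall x in A, forall y in A,
    [&& e u v, e x y, x != u, x != v, y != u & y != v] ==>
    ~~ cop (f u) (f x) (f y) (f v)].

Definition good_state (A : {set T}) (f : T -> P) : bool :=
  [&& [forall u in A, edge_load A f u <= T1],
      [forall x in A, vertex_load A f x <= T2] & crossing_free A f].

Lemma crossing_freeP (A : {set T}) (f : T -> P) :
  reflect (forall u v x y, u \in A -> v \in A -> x \in A -> y \in A ->
             e u v -> e x y -> x != u -> x != v -> y != u -> y != v ->
             ~~ cop (f u) (f x) (f y) (f v))
          (crossing_free A f).
Proof.
apply: (iffP forall_inP) => [h u v x y uA vA xA yA uv xy xu xv yu yv|h u uA].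
  have /forall_inP/(_ v vA)/forall_inP/(_ x xA)/forall_inP/(_ y yA) := h u uA.
  by rewrite uv xy xu xv yu yv.
apply/forall_inP => v vA; apply/forall_inP => x xA; apply/forall_inP => y yA.
by apply/implyP => /and5P[? ? ? ? /andP[? ?]]; exact: h.
Qed.

(** * Monotonicity and positivity of the loads *)

Lemma sum_setS_le (A B : {set T}) (F : T -> R) :
  A \subset B -> (forall x, 0 <= F x) -> \sum_(x in A) F x <= \sum_(x in B) F x.
Proof.
move=> AB F0; rewrite [leRHS](big_setID A) /= (finset.setIidPr AB).
by rewrite lerDl sumr_ge0.
Qed.

Lemma edge_load_mono (A B : {set T}) f u : A \subset B -> edge_load A f u <= edge_load B f u.
Proof.
move=> AB; apply: le_trans (_ : \sum_(x in A) \sum_(y in B) _ <= _); last first.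
  apply: sum_setS_le => // x; apply: sumr_ge0 => y _.
  by rewrite mulr_ge0 ?ler0n ?plane_size_ge0.
apply: ler_sum => x _; apply: sum_setS_le => // y.
by rewrite mulr_ge0 ?ler0n ?plane_size_ge0.
Qed.

Lemma vertex_load_mono (A B : {set T}) f u : A \subset B -> vertex_load A f u <= vertex_load B f u.
Proof.
move=> AB; apply: sum_setS_le => // x.
by rewrite !mulr_ge0 ?ler0n ?pencil_size_ge0.
Qed.

Lemma total_load_mono (A B : {set T}) f : A \subset B -> total_load A f <= total_load B f.
Proof.
move=> AB; apply: le_trans (_ : \sum_(x in A) \sum_(y in B) _ <= _); last first.
  apply: sum_setS_le => // x; apply: sumr_ge0 => y _.
  by rewrite mulr_ge0 ?ler0n ?pencil_size_ge0.
apply: ler_sum => x _; apply: sum_setS_le => // y.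
by rewrite mulr_ge0 ?ler0n ?pencil_size_ge0.
Qed.

Lemma edge_load_ge0 (A : {set T}) f u : 0 <= edge_load A f u.
Proof.
apply: sumr_ge0 => x _; apply: sumr_ge0 => y _.
by rewrite mulr_ge0 ?ler0n ?plane_size_ge0.
Qed.

Lemma vertex_load_ge0 (A : {set T}) f u : 0 <= vertex_load A f u.
Proof.
by apply: sumr_ge0 => x _; rewrite !mulr_ge0 ?ler0n ?pencil_size_ge0.
Qed.

(* Discarding a vertex of load above the threshold costs at most what its own
   term in the potential releases. *)
Lemma discard_overloaded (A B : {set T}) (h1 h2 : T -> R) (c : R) :
  0 < c -> B \subset A -> (forall u, 0 <= h1 u) -> (forall u, h1 u <= h2 u) ->
  {in B, forall u, h2 u <= c} ->
  \sum_(u in A | c < h2 u) w u + \sum_(u in B) w u * h1 u / c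
    <= \sum_(u in A) w u * h2 u / c.
Proof.
move=> c0 BA h1_ge0 h12 hB; rewrite [leRHS](bigID (fun u => c < h2 u)) /=.
have h2_ge0 u : 0 <= h2 u by exact: le_trans (h12 u).
apply: lerD.
  apply: ler_sum => u /andP[_ cu]; rewrite -mulrA ler_peMr //.
  by rewrite ler_pdivlMr // mul1r ltW.
rewrite -[leLHS]addr0 [X in _ <= X](bigID (mem B)) /=; apply: lerD; last first.
  by apply: sumr_ge0 => u _; rewrite divr_ge0 ?(ltW c0) ?mulr_ge0.
apply: (@le_trans _ _ (\sum_(u in B) w u * h2 u / c)).
  by apply: ler_sum => u _; rewrite ler_pM2r ?invr_gt0 // ler_wpM2l.
rewrite le_eqVlt; apply/orP; left; apply/eqP/eq_bigl => u.
case uB: (u \in B); rewrite ?andbF ?andbT //.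
by rewrite (fintype.subsetP BA) // -leNgt hB.
Qed.

(** * Average loads after a random placement of a new vertex *)

Definition extend (f : T -> P) (r : T) (p : P) : T -> P :=
  fun v => if v == r then p else f v.

Lemma extend_eq f r p : extend f r p r = p.
Proof. by rewrite /extend eqxx. Qed.

Lemma extend_in (A : {set T}) f r p x : r \notin A -> x \in A -> extend f r p x = f x.
Proof. by rewrite /extend => rA xA; case: eqVneq => // xr; rewrite -xr xA in rA. Qed.

Lemma setU1_neq (A : {set T}) r x : r \notin A -> x \in A -> (x == r) = false.
Proof. by move=> rA xA; apply/eqP => xr; rewrite -xr xA in rA. Qed.

(** Only the edges [rx] are new, and each is counted in both orders, hence the factor 2. *)
Lemma edge_load_extend (A : {set T}) f r p u : r \notin A -> u \in A ->
  edge_load (r |: A) (extend f r p) u =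
  edge_load A f u + 2 * \sum_(x in A) ((x != u) && e r x)%:R * pl (f u) (f x) p.
Proof.
move=> rA uA; rewrite /edge_load big_setU1 //= big_setU1 //= eirr !andbF mul0r add0r.
have ru : r != u by rewrite eq_sym (setU1_neq rA uA).
rewrite (extend_in f p rA uA).
have -> : \sum_(x in A) \sum_(y in r |: A)
    ([&& x != u, y != u & e x y])%:R * pl (f u) (extend f r p x) (extend f r p y) =
   \sum_(x in A) ((x != u) && e r x)%:R * pl (f u) (f x) p + edge_load A f u.
  rewrite -big_split /=; apply: eq_bigr => x xA.
  rewrite big_setU1 //= extend_eq (extend_in f p rA xA) ru esym; congr (_ + _).
  by apply: eq_bigr => y yA; rewrite (extend_in f p rA yA).
have -> : \sum_(y in A) ([&& r != u, y != u & e r y])%:R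
      * pl (f u) (extend f r p r) (extend f r p y) =
   \sum_(x in A) ((x != u) && e r x)%:R * pl (f u) (f x) p.
  by apply: eq_bigr => x xA; rewrite extend_eq (extend_in f p rA xA) ru plane_size23.
by rewrite /edge_load; ring.
Qed.

(** Expectations over the random position [p] of [r] are kept multiplied by [M], as sums over [p].
    Summing a plane size over its last point gives a pencil size, which is how vertex loads come
    in. *)
Lemma sum_edge_load_extend (A : {set T}) f r u : r \notin A -> u \in A ->
  \sum_p edge_load (r |: A) (extend f r p) u =
  M * edge_load A f u + 2 * \sum_(x in A) ((x != u) && e r x)%:R * pn (f u) (f x).
Proof.
move=> rA uA; under eq_bigr do rewrite edge_load_extend //.
rewrite big_split /= sumr_const -[_ *+ #|_|]mulr_natl -mulr_sumr exchange_big /=.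
by congr (_ + _ * _); apply: eq_bigr => x _; rewrite -mulr_sumr.
Qed.

(** Edges at [r] do not count in the load of [r], so only old edges [xy] contribute; each gives the
    number of coplanar completions of its two endpoints. *)
Lemma sum_edge_load_new (A : {set T}) f r : r \notin A ->
  \sum_p edge_load (r |: A) (extend f r p) r = total_load A f.
Proof.
move=> rA.
have E p : edge_load (r |: A) (extend f r p) r =
    \sum_(x in A) \sum_(y in A) (e x y)%:R * pl p (f x) (f y).
  rewrite /edge_load big_setU1 //= big1 ?add0r; last first.
    by move=> y _; rewrite eqxx mul0r.
  apply: eq_bigr => x xA; rewrite big_setU1 //= eqxx andbF mul0r add0r.
  apply: eq_bigr => y yA; rewrite extend_eq !(extend_in f p rA) //.
  by rewrite !(setU1_neq rA).
under eq_bigr do rewrite E.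
rewrite exchange_big /=; apply: eq_bigr => x xA.
rewrite exchange_big /=; apply: eq_bigr => y yA.
by rewrite -mulr_sumr sum_plane_size.
Qed.

Lemma sum_pencil_le a : \sum_p pn p a <= N.
Proof. by under eq_bigr do rewrite pencil_sizeC. Qed.

Lemma sum_vertex_load_extend (A : {set T}) f r x : r \notin A -> x \in A ->
  \sum_p vertex_load (r |: A) (extend f r p) x <= M * vertex_load A f x + w r * N.
Proof.
move=> rA xA.
have rx : r != x by rewrite eq_sym (setU1_neq rA xA).
have E p : vertex_load (r |: A) (extend f r p) x = vertex_load A f x + w r * pn p (f x).
  rewrite /vertex_load big_setU1 //= rx extend_eq (extend_in f p rA xA) mul1r addrC.
  by congr (_ + _); apply: eq_bigr => u uA; rewrite (extend_in f p rA uA).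
under eq_bigr do rewrite E.
rewrite big_split /= sumr_const -[_ *+ #|_|]mulr_natl lerD2l -mulr_sumr ler_pM2l //.
exact: sum_pencil_le.
Qed.

Lemma sum_vertex_load_new (A : {set T}) f r : r \notin A ->
  \sum_p vertex_load (r |: A) (extend f r p) r <= 4 * n * N.
Proof.
move=> rA.
have E p : vertex_load (r |: A) (extend f r p) r = \sum_(u in A) w u * pn (f u) p.
  rewrite /vertex_load big_setU1 //= eqxx !mul0r add0r extend_eq.
  by apply: eq_bigr => u uA; rewrite (extend_in f p rA uA) (setU1_neq rA uA) mul1r.
under eq_bigr do rewrite E.
rewrite exchange_big /=; under eq_bigr do rewrite -mulr_sumr.
apply: le_trans (_ : \sum_(u in A) w u * N <= _).
  by apply: ler_sum => u _; rewrite ler_pM2l // pencil_sum.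
rewrite -mulr_suml ler_pM2r //; apply: le_trans w_sum.
by rewrite [leRHS](bigID (mem A)) /= lerDl sumr_ge0.
Qed.

Lemma sum_total_load_extend (A : {set T}) f r : r \notin A ->
  \sum_p total_load (r |: A) (extend f r p) <= M * total_load A f + 2 * deg r * N.
Proof.
move=> rA.
have E p : total_load (r |: A) (extend f r p) =
    total_load A f + 2 * \sum_(x in A) (e r x)%:R * pn (f x) p.
  rewrite /total_load big_setU1 //= big_setU1 //= eirr mul0r add0r.
  have -> : \sum_(x in A) \sum_(y in r |: A)
      (e x y)%:R * pn (extend f r p x) (extend f r p y) =
      \sum_(x in A) (e r x)%:R * pn (f x) p + total_load A f.
    rewrite -big_split /=; apply: eq_bigr => x xA.
    rewrite big_setU1 //= extend_eq (extend_in f p rA xA) esym; congr (_ + _).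
    by apply: eq_bigr => y yA; rewrite (extend_in f p rA yA).
  have -> : \sum_(y in A) (e r y)%:R * pn (extend f r p r) (extend f r p y) =
      \sum_(x in A) (e r x)%:R * pn (f x) p.
    by apply: eq_bigr => x xA; rewrite extend_eq (extend_in f p rA xA) pencil_sizeC.
  by rewrite /total_load; ring.
under eq_bigr do rewrite E.
rewrite big_split /= sumr_const -[_ *+ #|_|]mulr_natl lerD2l -mulr_sumr exchange_big /=.
rewrite -mulrA ler_pM2l //.
under eq_bigr do rewrite -mulr_sumr.
apply: le_trans (_ : \sum_(x in A) (e r x)%:R * N <= _).
  by apply: ler_sum => x _; rewrite ler_wpM2l ?ler0n // pencil_sum.
rewrite -mulr_suml ler_pM2r // [leRHS](bigID (mem A)) /= lerDl.
by apply: sumr_ge0 => x _; rewrite ler0n.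
Qed.

(** * Discarding vertices after a placement *)

Definition blocked (A : {set T}) (f : T -> P) (u : T) (p : P) : bool :=
  [exists x in A, exists y in A,
    [&& x != u, y != u, e x y & cop (f u) (f x) (f y) p]].

(** A union bound: the edge load counts each blocked position once for every ordered edge [xy] that
    blocks it. *)
Lemma sum_blocked_le (A : {set T}) f u : \sum_p (blocked A f u p)%:R <= edge_load A f u.
Proof.
apply: le_trans (_ : \sum_p \sum_(x in A) \sum_(y in A)
    ([&& x != u, y != u & e x y])%:R * (cop (f u) (f x) (f y) p)%:R <= _); last first.
  rewrite le_eqVlt; apply/orP; left; apply/eqP.
  rewrite exchange_big /=; apply: eq_bigr => x _.
  by rewrite exchange_big /=; apply: eq_bigr => y _; rewrite -mulr_sumr.
apply: ler_sum => p _.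
have ge0 x y : 0 <= ([&& x != u, y != u & e x y])%:R
    * (cop (f u) (f x) (f y) p)%:R :> R by rewrite mulr_ge0 ?ler0n.
case: (boolP (blocked A f u p)) => [|_]; last first.
  by apply: sumr_ge0 => x _; apply: sumr_ge0.
case/exists_inP => x xA /exists_inP[y yA /and4P[xu yu xy cxy]].
rewrite (big_setD1 x) //= (big_setD1 y) //= -addrA -[leLHS]addr0.
apply: lerD; first by rewrite xu yu xy cxy mulr1.
by apply: addr_ge0; apply: sumr_ge0 => z _; [exact: ge0|apply: sumr_ge0].
Qed.

Definition discarded (A : {set T}) (f : T -> P) (r : T) (p : P) : {set T} :=
  let A' := r |: A in let f' := extend f r p in
  [set t r u | u in [set u in A | e r u && blocked A f u p]]
  :|: ([set u in A' | T1 < edge_load A' f' u]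
       :|: [set x in A' | T2 < vertex_load A' f' x]).

(** Loads only drop when vertices are discarded, so it suffices that the vertices overloaded before
    the removal are gone. A new coplanar pair consists of some edge [rv] and an old edge blocking
    [p] for [v]; then [t r v], one of [r] and [v], has been discarded. *)
Lemma good_extend (A : {set T}) f r p : r \notin A -> good_state A f ->
  good_state ((r |: A) :\: discarded A f r p) (extend f r p).
Proof.
move=> rA /and3P[_ _ /crossing_freeP cf].
set A' := r |: A; set f' := extend f r p; set B := discarded A f r p.
have sub : A' :\: B \subset A' by exact: finset.subsetDl.
apply/and3P; split.
- apply/forall_inP => u /setDP[uA' uB].
  apply: le_trans (edge_load_mono f' u sub) _.
  rewrite leNgt; apply: contra uB => h.
  by apply/setUP; right; apply/setUP; left; rewrite inE; apply/andP.
- apply/forall_inP => u /setDP[uA' uB].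
  apply: le_trans (vertex_load_mono f' u sub) _.
  rewrite leNgt; apply: contra uB => h.
  by apply/setUP; right; apply/setUP; right; rewrite inE; apply/andP.
have new v x y : v \in A -> v \notin B -> r \notin B -> x \in A -> y \in A ->
    e r v -> e x y -> x != v -> y != v -> ~~ cop (f v) (f x) (f y) p.
  move=> vA vB rB xA yA rv xy xv yv; apply/negP => c.
  suff : t r v \in B by case: (tE r v) => ->; apply/negP.
  rewrite inE; apply/orP; left; apply/imsetP; exists v => //.
  rewrite !inE vA rv /=; apply/exists_inP; exists x => //.
  by apply/exists_inP; exists y => //; rewrite xv yv xy.
have oldA x : x \in A' -> x != r -> x \in A.
  by rewrite !inE => /orP[/eqP->|//]; rewrite eqxx.
have fE x : x != r -> f' x = f x by rewrite /f' /extend => /negPf->.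
have fr : f' r = p by exact: extend_eq.
apply/crossing_freeP => u v x y /setDP[uA' uB] /setDP[vA' vB] /setDP[xA' xB]
  /setDP[yA' yB] uv xy xu xv yu yv.
(* The new vertex can be any one of the four endpoints; the symmetries of [cop] bring each case to
   [new]. *)
have [vr|vr] := eqVneq v r.
  subst v; have ur : u != r by apply: contraTneq uv => ->; rewrite eirr.
  rewrite fr !fE //; apply: new => //; try exact: oldA.
  by rewrite esym.
have [ur|ur] := eqVneq u r.
  subst u; rewrite fr !fE //.
  have -> : cop p (f x) (f y) (f v) = cop (f v) (f x) (f y) p.
    by rewrite cop34 cop23 cop12 cop23 cop34.
  by apply: new => //; exact: oldA.
have [xr|xr] := eqVneq x r.
  subst x; have yr : y != r by apply: contraTneq xy => ->; rewrite eirr.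
  rewrite fr !fE // -cop23 -cop34 -cop12.
  by apply: new; rewrite // ?oldA // eq_sym.
have [yr|yr] := eqVneq y r.
  subst y; rewrite fr !fE // -cop34 -cop12.
  by apply: new; rewrite // ?oldA // 1?esym // eq_sym.
by rewrite !fE //; apply: cf => //; exact: oldA.
Qed.

(** The weight of the expendable endpoints is charged to the second sum, and that of the overloaded
    vertices to their own load terms, so the right-hand side only involves the state before
    discarding. *)
Lemma potential_extend (A : {set T}) f r p : r \notin A ->
  potential ((r |: A) :\: discarded A f r p) (extend f r p) <=
  \sum_(v in ~: (r |: A)) w v + \sum_(u in A | e r u) w (t r u) * (blocked A f u p)%:R
  + \sum_(u in (r |: A)) w u * edge_load (r |: A) (extend f r p) u / T1
  + \sum_(x in (r |: A)) w x * vertex_load (r |: A) (extend f r p) x / T2 + kap * total_load (r |: A) (extend f r p).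
Proof.
move=> rA; set A' := r |: A; set f' := extend f r p; set B := discarded A f r p; set A2 := A' :\: B.
have sub : A2 \subset A' by exact: finset.subsetDl.
have edgeB : {in A2, forall u, edge_load A' f' u <= T1}.
  move=> u /setDP[uA' uB]; rewrite leNgt; apply: contra uB => h.
  by apply/setUP; right; apply/setUP; left; rewrite inE; apply/andP.
have vertexB : {in A2, forall u, vertex_load A' f' u <= T2}.
  move=> u /setDP[uA' uB]; rewrite leNgt; apply: contra uB => h.
  by apply/setUP; right; apply/setUP; right; rewrite inE; apply/andP.
have hF := discard_overloaded T1_gt0 sub (fun u => edge_load_ge0 A2 f' u)
  (fun u => edge_load_mono f' u sub) edgeB.
have hQ := discard_overloaded T2_gt0 sub (fun u => vertex_load_ge0 A2 f' u)
  (fun u => vertex_load_mono f' u sub) vertexB.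
have hG : kap * total_load A2 f' <= kap * total_load A' f'.
  by rewrite ler_pM2l // total_load_mono.
have sumU (X Y : {set T}) :
    \sum_(v in X :|: Y) w v <= \sum_(v in X) w v + \sum_(v in Y) w v.
  rewrite (bigID (mem X)) /=; apply: lerD.
    by rewrite le_eqVlt; apply/orP; left; apply/eqP/eq_bigl => v; rewrite inE; case: (v \in X); rewrite ?andbF.
  rewrite [leRHS](bigID (mem X)) /= -[leLHS]add0r; apply: lerD; first exact: sumr_ge0.
  by rewrite le_eqVlt; apply/orP; left; apply/eqP/eq_bigl => v; rewrite inE; case: (v \in X); rewrite ?andbF.
have hC : \sum_(v in ~: A2) w v <= \sum_(v in ~: A') w v + \sum_(v in B) w v.
  by rewrite /A2 setCD; exact: sumU.
have hB : \sum_(v in B) w v <= \sum_(u in A | e r u) w (t r u) * (blocked A f u p)%:R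
   + (\sum_(u in A' | T1 < edge_load A' f' u) w u
     + \sum_(u in A' | T2 < vertex_load A' f' u) w u).
  apply: le_trans (sumU _ _) _; apply: lerD; last first.
    apply: le_trans (sumU _ _) _.
    by under eq_bigl do rewrite inE; under [X in _ + X <= _]eq_bigl do rewrite inE.
  apply: le_trans (_ : \sum_(u in [set u in A | e r u && blocked A f u p]) w (t r u) <= _).
    (* Several [u] may have the same expendable endpoint [r], whose weight is lost only once. *)
    apply: (@le_trans _ _ (\sum_(v in [set t r u | u in [set u in A | e r u && blocked A f u p]])
       \sum_(u in [set u in A | e r u && blocked A f u p] | t r u == v) w (t r u))).
      apply: ler_sum => v /imsetP[u uS ->].
      rewrite (bigD1 u) ?eqxx ?andbT //= lerDl; exact: sumr_ge0.
    by rewrite -partition_big_imset.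
  rewrite le_eqVlt; apply/orP; left; apply/eqP.
  rewrite big_mkcond [RHS]big_mkcond; apply: eq_bigr => u _; rewrite inE.
  by case: (u \in A) => //=; case: (e r u) => //=; case: blocked; rewrite ?mulr1 ?mulr0.
rewrite /potential; lra.
Qed.

(** Averaging over [p]: if no position decreased the potential, summing over all of them would bound
    the released amount [M * w r] by five losses, each at most [M * w r / 8]. *)
Lemma potential_decreases (A : {set T}) f r :
  r \notin A -> good_state A f -> potential A f <= 4 * n ->
  exists p, potential ((r |: A) :\: discarded A f r p) (extend f r p) < potential A f.
Proof.
move=> rA gA pA.
case: (boolP [exists p, potential ((r |: A) :\: discarded A f r p) (extend f r p)
   < potential A f]) => [/existsP//|/existsPn noP]; exfalso.
have /and3P[/forall_inP gF /forall_inP gQ _] := gA.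
set W := \sum_(v in ~: (r |: A)) w v.
have WE : \sum_(v in ~: A) w v = w r + W.
  rewrite (big_setD1 r) ?inE //=; congr (_ + _); apply: eq_bigl => v.
  by rewrite !inE negb_or.
set G := total_load A f.
have sumA : \sum_(u in A) w u <= 4 * n.
  by apply: le_trans w_sum; rewrite [leRHS](bigID (mem A)) /= lerDl sumr_ge0.
(* The bound on the potential becomes a bound on the total load, hence on the expected edge load of
   [r]. *)
have hG : kap * G <= 4 * n.
  apply: le_trans pA; rewrite /potential lerDr !addr_ge0 ?sumr_ge0 //.
    by move=> u _; rewrite divr_ge0 ?(ltW T1_gt0) // mulr_ge0 ?edge_load_ge0.
  by move=> u _; rewrite divr_ge0 ?(ltW T2_gt0) // mulr_ge0 ?vertex_load_ge0.
have degA : \sum_(x in A) (e r x)%:R <= deg r.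
  by rewrite [leRHS](bigID (mem A)) /= lerDl; apply: sumr_ge0 => x _; rewrite ler0n.
have S1 : \sum_p \sum_(u in A | e r u) w (t r u) * (blocked A f u p)%:R <= 3 * D%:R * w r * T1.
  rewrite exchange_big /=.
  apply: le_trans (_ : \sum_(u | e r u) w (t r u) * T1 <= _); last first.
    by rewrite -mulr_suml ler_pM2r.
  apply: le_trans (_ : \sum_(u in A | e r u) w (t r u) * T1 <= _); last first.
    rewrite [leRHS](bigID (mem A)) /= [leLHS](eq_bigl (fun u => e r u && (u \in A))); last first.
      by move=> u; rewrite andbC.
    by rewrite lerDl; apply: sumr_ge0 => u _; rewrite mulr_ge0 // ltW.
  apply: ler_sum => u /andP[uA _]; rewrite -mulr_sumr ler_pM2l //.
  exact: le_trans (sum_blocked_le _ _ _) (gF u uA).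
have S2 : \sum_p \sum_(u in r |: A) w u * edge_load (r |: A) (extend f r p) u / T1 <=
    M * (\sum_(u in A) w u * edge_load A f u / T1) + w r * G / T1
    + 2 * deg r * T2 / T1.
  rewrite exchange_big /= big_setU1 //=.
  rewrite -mulr_suml -mulr_sumr sum_edge_load_new // -/G.
  (* After exchanging the sums, the weighted growth of all edge loads is twice the sum of the vertex
     loads at the neighbours of [r], each of which is at most [T2]. *)
  have -> : \sum_(u in A) \sum_p w u * edge_load (r |: A) (extend f r p) u / T1 =
     M * (\sum_(u in A) w u * edge_load A f u / T1) +
     2 / T1 * \sum_(x in A) (e r x)%:R * vertex_load A f x.
    rewrite mulr_sumr mulr_sumr.
    under [X in _ = _ + X]eq_bigr do rewrite /vertex_load mulr_sumr mulr_sumr.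
    rewrite [X in _ = _ + X]exchange_big /= -big_split /=; apply: eq_bigr => u uA.
    rewrite -mulr_suml -mulr_sumr sum_edge_load_extend // mulrDr mulrDl.
    congr (_ + _); first by ring.
    rewrite !mulr_sumr mulr_suml; apply: eq_bigr => x _.
    by rewrite -mulnb natrM eq_sym; ring.
  rewrite addrCA addrA lerD2l.
  have -> : 2 * deg r * T2 / T1 = 2 / T1 * (deg r * T2) by ring.
  rewrite ler_pM2l; last exact: divr_gt0.
  apply: le_trans (_ : \sum_(x in A) (e r x)%:R * T2 <= _).
    by apply: ler_sum => x xA; rewrite ler_wpM2l ?ler0n ?gQ.
  by rewrite -mulr_suml ler_pM2r.
have S3 : \sum_p \sum_(x in r |: A) w x * vertex_load (r |: A) (extend f r p) x / T2 <=
    M * (\sum_(x in A) w x * vertex_load A f x / T2) + w r * (8 * n * N) / T2.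
  rewrite exchange_big /= big_setU1 //=.
  rewrite -mulr_suml -mulr_sumr.
  have h1 : w r * (\sum_p vertex_load (r |: A) (extend f r p) r) / T2 <= w r * (4 * n * N) / T2.
    by rewrite ler_pM2r ?invr_gt0 // ler_pM2l // sum_vertex_load_new.
  have h2 : \sum_(x in A) \sum_p w x * vertex_load (r |: A) (extend f r p) x / T2 <=
      M * (\sum_(x in A) w x * vertex_load A f x / T2) + w r * (4 * n * N) / T2.
    apply: le_trans (_ : \sum_(x in A) w x * (M * vertex_load A f x + w r * N) / T2 <= _).
      apply: ler_sum => x xA; rewrite -mulr_suml -mulr_sumr.
      by rewrite ler_pM2r ?invr_gt0 // ler_pM2l // sum_vertex_load_extend.
    have -> : \sum_(x in A) w x * (M * vertex_load A f x + w r * N) / T2 =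
       M * (\sum_(x in A) w x * vertex_load A f x / T2) + (\sum_(x in A) w x) * (w r * N / T2).
      rewrite mulr_sumr mulr_suml -big_split /=; apply: eq_bigr => x _; ring.
    rewrite lerD2l.
    have -> : w r * (4 * n * N) / T2 = (4 * n) * (w r * N / T2) by ring.
    by rewrite ler_wpM2r // divr_ge0 ?(ltW T2_gt0) // mulr_ge0 // ltW.
  apply: le_trans (lerD h1 h2) _.
  by rewrite le_eqVlt; apply/orP; left; apply/eqP; ring.
have S4 := sum_total_load_extend f rA.
have tot : M * potential A f <= M * W + 3 * D%:R * w r * T1
   + (M * (\sum_(u in A) w u * edge_load A f u / T1) + w r * G / T1 + 2 * deg r * T2 / T1)
   + (M * (\sum_(x in A) w x * vertex_load A f x / T2) + w r * (8 * n * N) / T2)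
   + kap * (M * G + 2 * deg r * N).
  have -> : M * potential A f = \sum_(p : P) potential A f.
    by rewrite sumr_const -[_ *+ #|_|]mulr_natl.
  apply: le_trans (_ : \sum_p (W +
     \sum_(u in A | e r u) w (t r u) * (blocked A f u p)%:R
     + \sum_(u in r |: A) w u * edge_load (r |: A) (extend f r p) u / T1
     + \sum_(x in r |: A) w x * vertex_load (r |: A) (extend f r p) x / T2
     + kap * total_load (r |: A) (extend f r p)) <= _).
    apply: ler_sum => p _; apply: le_trans (potential_extend f p rA).
    by rewrite leNgt noP.
  rewrite !big_split /=; apply: lerD; last by rewrite -mulr_sumr ler_pM2l.
  apply: lerD => //. apply: lerD => //. apply: lerD => //.
  by rewrite sumr_const -[_ *+ #|_|]mulr_natl.
have wr := w_gt0 r.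
have degr : deg r * n <= w r * K by rewrite -ler_pdivrMr // w_deg.
have Mw : 0 < M * w r by exact: mulr_gt0.
have b1 : 3 * D%:R * w r * T1 = M * w r / 8.
  by rewrite /T1; field; rewrite gt_eqF.
have DKN : 0 < D%:R * K * N by rewrite !mulr_gt0.
have M2 : 0 < M ^+ 2 by rewrite exprn_gt0.
have b2 : w r * G / T1 <= M * w r / 8.
  have GE : G <= 64 * K * N / M.
    move: hG; rewrite -ler_pdivlMl // => /le_trans; apply.
    by rewrite /kap le_eqVlt; apply/orP; left; apply/eqP; field; rewrite !gt_eqF.
  have -> : M * w r / 8 = w r * (M / 8) by ring.
  rewrite -mulrA ler_pM2l //.
  apply: le_trans (_ : 64 * K * N / M / T1 <= _).
    by rewrite ler_pM2r // invr_gt0.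
  have -> : 64 * K * N / M / T1 = 1536 * (D%:R * K * N) / M ^+ 2.
    by rewrite /T1; field; rewrite !gt_eqF.
  rewrite ler_pdivrMr //.
  have -> : M / 8 * M ^+ 2 = M ^+ 3 / 8 by field.
  by move: M_big DKN; lra.
have b3 : 2 * deg r * T2 / T1 <= M * w r / 8.
  have -> : 2 * deg r * T2 / T1 = 3072 * (deg r * n * (D%:R * N)) / M ^+ 2.
    by rewrite /T1 /T2; field; rewrite !gt_eqF.
  rewrite ler_pdivrMr //.
  have -> : M * w r / 8 * M ^+ 2 = w r * M ^+ 3 / 8 by field.
  have h1 : deg r * n * (D%:R * N) <= w r * K * (D%:R * N).
    by rewrite ler_pM2r // mulr_gt0.
  have h2 : w r * (32%:R ^+ 3 * D%:R * K * N) <= w r * M ^+ 3 by rewrite ler_pM2l.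
  have h3 : 0 < w r * (D%:R * K * N) by rewrite mulr_gt0.
  lra.
have b4 : w r * (8 * n * N) / T2 = M * w r / 8.
  by rewrite /T2; field; rewrite !gt_eqF.
have b5 : kap * (2 * deg r * N) <= M * w r / 8.
  have -> : kap * (2 * deg r * N) = deg r * n / K * (M / 8).
    by rewrite /kap; field; rewrite !gt_eqF.
  have -> : M * w r / 8 = w r * (M / 8) by ring.
  by rewrite ler_pM2r ?divr_gt0.
have : M * (w r) <= 5 * (M * w r / 8).
  have pE : M * potential A f = M * (w r + W) +
     M * (\sum_(u in A) w u * edge_load A f u / T1) +
     M * (\sum_(x in A) w x * vertex_load A f x / T2) + M * kap * G.
    by rewrite /potential WE -/G; ring.
  lra.
lra.
Qed.

Lemma exists_good_state : exists f : T -> P, good_state [set: T] f.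
Proof.
have /card_gt0P[p0 _] : (0 < #|P|)%N by rewrite -(ltr0n R).
(* States form a finite type, so a minimiser exists. The maps are total; [p0] is an arbitrary value
   for unplaced vertices. *)
pose s0 : {set T} * {ffun T -> P} := (finset.set0, [ffun=> p0]).
have g0 : good_state s0.1 s0.2.
  apply/and3P; split; [| |apply/crossing_freeP => u v x y].
  - by apply/forall_inP => u; rewrite inE.
  - by apply/forall_inP => u; rewrite inE.
  by rewrite inE.
pose gd (s : {set T} * {ffun T -> P}) := good_state s.1 s.2.
pose pt (s : {set T} * {ffun T -> P}) := potential s.1 s.2.
case: (@Order.TotalTheory.arg_minP _ _ _ s0 gd pt g0) => -[A f] /= gA minA.
have pA : potential A f <= 4 * n.
  apply: le_trans (minA s0 g0) _; rewrite /pt /potential /total_load !big_set0.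
  rewrite mulr0 !addr0; apply: le_trans w_sum; rewrite le_eqVlt; apply/orP; left.
  by apply/eqP/eq_bigl => v; rewrite !inE.
have [AT|/existsPn nA] := boolP [exists r, r \notin A]; last first.
  exists f; rewrite (_ : [set: T] = A) //; apply/setP => v.
  by rewrite inE (negbNE (nA v)).
have [r rA] := existsP AT.
have [p] := potential_decreases rA gA pA.
have fE : ([ffun v => extend f r p v] : T -> P) = extend f r p.
  by apply/funext => v; rewrite ffunE.
have := minA ((r |: A) :\: discarded A f r p, [ffun v => extend f r p v]).
rewrite /gd /pt /= fE => /(_ (good_extend p rA gA)).
by rewrite leNgt => /negP.
Qed.

(** Once all vertices are placed, [T1 < M] and [T2 < M ^+ 2] keep plane and pencil sizes below their
    largest possible values, which rules out degenerate triples and pairs. *)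
Lemma exists_load_bounded_placement : exists f : T -> P,
  [/\ forall u v x y, e u v -> e x y -> x != u -> x != v -> y != u -> y != v ->
        ~~ cop (f u) (f x) (f y) (f v),
      forall u x y, e x y -> x != u -> y != u -> pl (f u) (f x) (f y) < M
    & forall u x, u != x -> pn (f u) (f x) < M ^+ 2].
Proof.
have [f /and3P[/forall_inP gF /forall_inP gQ /crossing_freeP cf]] := exists_good_state.
exists f; split.
- by move=> u v x y; apply: cf; rewrite inE.
- move=> u x y xy xu yu; apply: le_lt_trans (_ : T1 < M); last first.
    rewrite ltr_pdivrMr ?mulr_gt0 // ltr_pMr //.
    have : 1 <= D%:R :> R by rewrite ler1n.
    lra.
  apply: le_trans (gF u _); rewrite ?inE // /edge_load.
  rewrite (big_setD1 x) ?inE //= (big_setD1 y) ?inE //= xu yu xy mul1r -addrA lerDl.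
  apply: addr_ge0; apply: sumr_ge0 => z _.
    by rewrite mulr_ge0 ?ler0n ?plane_size_ge0.
  by apply: sumr_ge0 => z' _; rewrite mulr_ge0 ?ler0n ?plane_size_ge0.
move=> u x ux; apply: le_lt_trans (_ : T2 < _).
  apply: le_trans (gQ x _); rewrite ?inE // /vertex_load.
  rewrite (big_setD1 u) ?inE //= ux mul1r -[leLHS]addr0; apply: lerD.
    by rewrite ler_peMl ?pencil_size_ge0.
  by apply: sumr_ge0 => z _; rewrite !mulr_ge0 ?ler0n ?pencil_size_ge0.
rewrite /T2 ltr_pdivrMr // -exprSr; apply: lt_le_trans M_big.
have h1 : n * N <= D%:R * K * N.
  rewrite ler_pM2r //; apply: le_trans K_ge _; rewrite ler_peMl ?(ltW K_gt0) //.
  by rewrite ler1n.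
have h2 : 0 < n * N by rewrite mulr_gt0.
lra.
Qed.

End Placement.

Theorem exists_placement (R : realFieldType) (P T : finType)
    (cop : P -> P -> P -> P -> bool) (e : rel T) (D : nat) (N : R) :
  (forall a b c d, cop b a c d = cop a b c d) ->
  (forall a b c d, cop a c b d = cop a b c d) ->
  (forall a b c d, cop a b d c = cop a b c d) ->
  symmetric e -> irreflexive e -> (0 < D)%N ->
  (forall S : {set T}, S != finset.set0 ->
     exists2 x, x \in S & (#|[set y in S | e x y]| <= D)%N) ->
  (forall a, \sum_b pencil_size R cop a b <= N) ->
  0 < N -> (0 < #|P|)%N -> (0 < #|T|)%N ->
  #|T|%:R <= \sum_u \sum_v (e u v)%:R :> R ->
  32%:R ^+ 3 * D%:R * (\sum_u \sum_v (e u v)%:R) * N <= #|P|%:R ^+ 3 ->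
  exists f : T -> P,
  [/\ forall u v x y, e u v -> e x y -> x != u -> x != v -> y != u -> y != v ->
        ~~ cop (f u) (f x) (f y) (f v),
      forall u x y, e x y -> x != u -> y != u ->
        plane_size R cop (f u) (f x) (f y) < #|P|%:R
    & forall u x, u != x -> pencil_size R cop (f u) (f x) < #|P|%:R ^+ 2].
Proof.
move=> c12 c23 c34 es ei D0 hdeg hN N0 P0 T0 TK big.
set K := \sum_u \sum_v (e u v)%:R in TK big.
have n0 : 0 < #|T|%:R :> R by rewrite ltr0n.
have K0 : 0 < K by exact: lt_le_trans TK.
(* The two summands provide the two lower bounds on [w]. Each sums to [n], and [degenerate_weights]
   doubles the total, whence [4 * n]. *)
pose w0 v : R := 1 + (\sum_u (e v u)%:R) * #|T|%:R / K.
have frac_ge0 v : 0 <= (\sum_u (e v u)%:R) * #|T|%:R / K.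
  by rewrite divr_ge0 ?(ltW K0) // mulr_ge0 ?ler0n // sumr_ge0.
have w0_ge0 v : 0 <= w0 v by rewrite addr_ge0.
have [w [t [ww tt sumt sumw]]] := degenerate_weights D0 es ei hdeg w0_ge0.
apply: (@exists_load_bounded_placement R P T cop c12 c23 c34 e D N K w t) => //.
- by rewrite ltr0n.
- by move=> v; apply: le_trans (ww v); rewrite lerDl.
- by move=> v; apply: le_trans (ww v); rewrite lerDr.
apply: le_trans sumw _.
have -> : \sum_v w0 v = 2 * #|T|%:R.
  rewrite big_split /= sumr_const -!mulr_suml -/K mulrAC divff ?gt_eqF // mul1r.
  by rewrite mulr_natl mulr2n.
lra.
Qed.

(** * Counting coplanar quadruples *)

Definition det3 (R : comNzRingType) (u v w : 'rV[R]_3) : R :=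
  let x (a : 'rV[R]_3) := a 0 0 in
  let y (a : 'rV[R]_3) := a 0 1 in
  let z (a : 'rV[R]_3) := a 0 2%:R in
  x u * (y v * z w - z v * y w) - y u * (x v * z w - z v * x w)
  + z u * (x v * y w - y v * x w).

Lemma det3E (R : comNzRingType) (u v w : 'rV[R]_3) :
  det3 u v w = \det (\matrix_(i, j) [:: u; v; w]`_i 0 j).
Proof.
pose F (a : 'rV[R]_3) (k : nat) := a 0 (inord k).
have FE (a : 'rV[R]_3) j : a 0 j = F a j by rewrite /F inord_val.
have -> : (\matrix_(i, j) [:: u; v; w]`_i 0 j) =
    \matrix_(i < 3, j < 3) F [:: u; v; w]`_i j.
  by apply/matrixP => i j; rewrite !mxE FE.
rewrite (expand_det_row _ 0) !big_ord_recl big_ord0 /cofactor.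
rewrite !(expand_det_row _ 0) !big_ord_recl !big_ord0 /cofactor !det_mx11 !mxE /=.
by rewrite /bump /= /det3 !FE /=; ring.
Qed.

Definition sup_norm (v : 'rV[int]_3) : nat := \max_j absz (v 0%R j).

Lemma sup_norm_ge (v : 'rV[int]_3) j : (absz (v 0%R j) <= sup_norm v)%N.
Proof. exact: (bigop.leq_bigmax (F := fun j => absz (v 0 j))). Qed.

Lemma sup_norm_attained (v : 'rV[int]_3) : exists j, absz (v 0 j) = sup_norm v.
Proof.
have [|j h] := @bigop.eq_bigmax _ (fun j => absz (v 0 j)); first by rewrite card_ord.
by exists j.
Qed.

Lemma sup_norm_eq0 (v : 'rV[int]_3) : sup_norm v = 0%N -> v = 0.
Proof.
move=> v0; apply/rowP => j; rewrite mxE.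
by have := sup_norm_ge v j; rewrite v0 leqn0 absz_eq0 => /eqP.
Qed.

Lemma sup_normZ x (v : 'rV[int]_3) : sup_norm (x *: v) = (`|x| * sup_norm v)%N.
Proof.
apply/eqP; rewrite eqn_leq; apply/andP; split.
  apply/bigop.bigmax_leqP => j _; rewrite mxE abszM leq_mul2l sup_norm_ge orbT //.
by have [j <-] := sup_norm_attained v; have := sup_norm_ge (x *: v) j; rewrite mxE abszM.
Qed.

(** In the Smith normal form [L d Q] the invariant factors form a divisibility chain with product
    zero, so the third vanishes and the rows are integer combinations of the first two rows of
    [Q]. *)
Lemma det3_eq0_rank2 (a b c : 'rV[int]_3) : det3 a b c = 0 ->
  exists e1 e2 : 'rV[int]_3, {in [:: a; b; c], forall v, exists x y, v = x *: e1 + y *: e2}.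
Proof.
rewrite det3E; set M := (\matrix_(i, j) _) => detM.
have [L Lu [Q Qu [d dsort ME]]] := int_Smith_normal_form M.
have d2 : d`_2 = 0.
  have : \det M = 0 by [].
  rewrite ME !det_mulmx.
  have -> : (\matrix_(i, j) (d`_i *+ (i == j :> nat)) : 'M[int]_3) = diag_mx (\row_i d`_i).
    by apply/matrixP => i j; rewrite !mxE.
  move: Lu Qu; rewrite !unitmxE => Lu Qu.
  rewrite det_diag => /eqP; rewrite !mulf_eq0 => /orP[/orP[/eqP L0|]|/eqP Q0].
  - by rewrite L0 unitr0 in Lu.
  - rewrite !big_ord_recl big_ord0 !mxE /= mulr1 !mulf_eq0.
    case: d dsort {ME} => [|x0 [|x1 [|x2 d]]] //.
    move=> /and3P[h1 h2 _] /or3P[] /eqP dd //.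
      have x10 : x1 = 0 by apply/eqP; rewrite -dvd0z -[X in (X %| _)%Z]dd.
      by apply/eqP; rewrite -dvd0z -[X in (X %| _)%Z]x10.
    by apply/eqP; rewrite -dvd0z -[X in (X %| _)%Z]dd.
  - by rewrite Q0 unitr0 in Qu.
exists (row 0 Q), (row 1 Q).
have rowM k : exists x y, row k M = x *: row 0 Q + y *: row 1 Q.
  exists (L k 0 * d`_0), (L k 1 * d`_1).
  rewrite ME -mulmxA row_mul mulmx_sum_row !big_ord_recl big_ord0 !mxE.
  rewrite !row_mul !mulmx_sum_row !big_ord_recl !big_ord0 !mxE /=.
  have -> : lift ord0 ord0 = 1 :> 'I_3 by exact: val_inj.
  have -> : d`_(bump 0 (bump 0 0)) = 0 by exact: d2.
  by rewrite !mulr0n !mul0rn !mulr1n !scale0r ?(addr0, add0r) scaler0 addr0 !scalerA.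
have E k : row k M = [:: a; b; c]`_k by apply/rowP => j; rewrite !mxE.
move=> v; rewrite !inE => /or3P[] /eqP ->.
- by have := rowM 0; rewrite E.
- by have := rowM 1; rewrite E.
- by have := rowM 2%:R; rewrite E.
Qed.

(** * Reduced bases of planar lattices *)

Lemma nearest_multiple (x y : int) : x != 0 -> exists t, (2 * absz (y - t * x)%R <= absz x)%N.
Proof.
move=> x0; have yE := divz_eq y x.
have r0 := modz_ge0 y x0; have rx := ltz_mod y x0.
set q := (y %/ x)%Z in yE; set r := (y %% x)%Z in yE r0 rx.
have [h|h] := lerP (2 * r) `|x|; first by exists q; rewrite yE; lia.
have [xp|xn] := ltrP 0 x; [exists (q + 1)|exists (q - 1)]; rewrite yE; lia.
Qed.

Definition bounded_comb (m : nat) (e1 e2 v : 'rV[int]_3) : Prop :=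
  exists x y, [/\ v = x *: e1 + y *: e2, (absz x * sup_norm e1 <= 3 * m)%N
    & (absz y * sup_norm e2 <= 4 * m)%N].

(** The bound on entry [i] of [e2] is what makes the count work: with norms [s1 <= s2] it leaves
    [O(s1^3 s2)] pairs instead of [O(s1^2 s2^2)]. *)
Definition reduced_pair (m : nat) (e1 e2 : 'rV[int]_3) (i j : 'I_3) : Prop :=
  [/\ i != j, absz (e1 0 i) = sup_norm e1, absz (e2 0 j) = sup_norm e2,
      (absz (e2 0%R i) <= sup_norm e1)%N
    & [/\ (0 < sup_norm e1)%N, (sup_norm e1 <= sup_norm e2)%N
        & (sup_norm e2 <= 4 * m)%N]].

Lemma sup_norm_delta j : sup_norm (delta_mx 0 j) = 1%N.
Proof.
apply/eqP; rewrite eqn_leq; apply/andP; split.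
  by apply/bigop.bigmax_leqP => k _; rewrite mxE eqxx /=; case: (k == j).
by have := sup_norm_ge (delta_mx 0 j) j; rewrite mxE !eqxx.
Qed.

(** Collinear vectors are fitted into the same format by adding an arbitrary second vector, taken
    with coefficient 0. *)
Lemma rank1_reduced_pair m (V : seq 'rV[int]_3) (e : 'rV[int]_3) : (0 < m)%N ->
  {in V, forall v, (sup_norm v <= m)%N} -> {in V, forall v, exists x, v = x *: e} ->
  exists e1 e2 i j, reduced_pair m e1 e2 i j /\ {in V, forall v, bounded_comb m e1 e2 v}.
Proof.
move=> m0 Vm Ve.
(* If [e] is zero or longer than [m], all vectors of [V] are zero and a unit vector can replace
   [e]. *)
wlog [e0 em] : e Ve / (0 < sup_norm e)%N /\ (sup_norm e <= m)%N => [hw|].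
  have [e0|e0] := posnP (sup_norm e).
    apply: (hw (delta_mx 0 0)); rewrite ?sup_norm_delta // => v vV; exists 0.
    by have [x ->] := Ve v vV; rewrite (sup_norm_eq0 e0) scaler0 scale0r.
  have [em|em] := leqP (sup_norm e) m; first exact: (hw e).
  apply: (hw (delta_mx 0 0)); rewrite ?sup_norm_delta // => v vV; exists 0.
  have [x vE] := Ve v vV; have := Vm v vV; rewrite vE sup_normZ scale0r => h.
  have -> : x = 0 by apply/eqP; rewrite -absz_eq0; nia.
  by rewrite scale0r.
have [i ei] := sup_norm_attained e.
have [j ij] : exists j : 'I_3, i != j.
  by have [->|i0] := eqVneq i 0; [exists 1|exists 0].
exists e, ((sup_norm e)%:Z *: delta_mx 0 j), i, j; split.
  split=> //; rewrite ?sup_normZ ?sup_norm_delta ?mxE ?eqxx ?(negPf ij) /=; try lia.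
  by split; lia.
move=> v vV; have [x vE] := Ve v vV; exists x, 0.
rewrite scale0r addr0; split => //.
by have := Vm v vV; rewrite vE sup_normZ; lia.
Qed.

(* Gauss reduction, by descent on the sum of the two norms. *)
Lemma rank2_reduced_pair m (V : seq 'rV[int]_3) (e1 e2 : 'rV[int]_3) : (0 < m)%N ->
  {in V, forall v, (sup_norm v <= m)%N} ->
  {in V, forall v, exists x y, v = x *: e1 + y *: e2} ->
  exists e1 e2 i j, reduced_pair m e1 e2 i j /\ {in V, forall v, bounded_comb m e1 e2 v}.
Proof.
move=> m0 Vm.
have [k] := ubnP (sup_norm e1 + sup_norm e2); elim: k e1 e2 => // k IH e1 e2 lek.
wlog le12 : e1 e2 lek / (sup_norm e1 <= sup_norm e2)%N => [hw|] Ve.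
  have [h|/ltnW h] := leqP (sup_norm e1) (sup_norm e2); first exact: (hw e1 e2).
  apply: (hw e2 e1) => //; first by rewrite addnC.
  by move=> v vV; have [x [y ->]] := Ve v vV; exists y, x; rewrite addrC.
have [e10|e1p] := posnP (sup_norm e1).
  apply: (rank1_reduced_pair m0 Vm (e := e2)) => v vV.
  have [x [y ->]] := Ve v vV; exists y.
  by rewrite (sup_norm_eq0 e10) scaler0 add0r.
have [i ei] := sup_norm_attained e1.
have e1i0 : e1 0 i != 0 by rewrite -absz_eq0 ei -lt0n.
have [t ht] := nearest_multiple (e2 0 i) e1i0.
(* Subtracting the nearest multiple makes entry [i] at most half the norm of [e1]. Either the norm
   drops and the descent goes on, or the pair is reduced up to the bound [4 * m]. *)
pose f := e2 - t *: e1.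
have Vf : {in V, forall v, exists x y, v = x *: e1 + y *: f}.
  move=> v vV; have [x [y ->]] := Ve v vV; exists (x + y * t), y.
  by rewrite /f scalerBr scalerDl scalerA -addrA [_ *: e1 + (_ - _)]addrC subrK.
have fi : (2 * absz (f 0%R i) <= sup_norm e1)%N by rewrite /f !mxE -ei.
clearbody f.
have [flt|fge] := ltnP (sup_norm f) (sup_norm e2).
  by apply: (IH e1 f) => //; lia.
have coefs v x y : v \in V -> v = x *: e1 + y *: f ->
    (absz x * sup_norm e1 <= 3 * m)%N /\ (absz y * sup_norm f <= 4 * m)%N.
  move=> vV vE; have [j fj] := sup_norm_attained f.
  have vi : v 0 i = x * e1 0 i + y * f 0 i by rewrite vE !mxE.
  have vj : v 0 j = x * e1 0 j + y * f 0 j by rewrite vE !mxE.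
  have hi := leq_trans (sup_norm_ge v i) (Vm v vV).
  have hj := leq_trans (sup_norm_ge v j) (Vm v vV).
  have e1j := sup_norm_ge e1 j.
  (* With [a = |x| |e1|] and [b = |y| |f|], entries [i] and [j] of [v] give [a <= m + b / 2] and
     [b <= m + a], whence [a <= 3 m] and [b <= 4 m]. *)
  have X : (absz x * sup_norm e1 <= m + absz y * absz (f 0%R i))%N.
    by rewrite -ei -!abszM; move: hi; rewrite vi; move: (x * _) (y * _) => p q; lia.
  have Y : (absz y * sup_norm f <= m + absz x * absz (e1 0%R j))%N.
    by rewrite -fj -!abszM; move: hj; rewrite vj; move: (x * _) (y * _) => p q; lia.
  have Z : (absz y * (2 * absz (f 0%R i)) <= absz y * sup_norm f)%N.
    by rewrite leq_mul2l; apply/orP; right; lia.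
  have U : (absz x * absz (e1 0%R j) <= absz x * sup_norm e1)%N.
    by rewrite leq_mul2l e1j orbT.
  by split; lia.
have [j fj] := sup_norm_attained f.
have [fm|fm] := leqP (sup_norm f) (4 * m); last first.
  (* When [f] is longer than [4 * m], its coefficient must vanish, and [e1] alone generates [V]. *)
  apply: (rank1_reduced_pair m0 Vm (e := e1)) => v vV.
  have [x [y vE]] := Vf v vV; exists x.
  have [_ h] := coefs v x y vV vE.
  have y0 : y = 0 by apply/eqP; rewrite -absz_eq0; nia.
  by rewrite vE y0 scale0r addr0.
exists e1, f, i, j; split.
  have ij : i != j by apply/eqP => ij; move: fi; rewrite ij fj; lia.
  by split=> //; [apply: leq_trans fi; rewrite leq_pmull|split=> //; lia].
move=> v vV; have [x [y vE]] := Vf v vV; have [h1 h2] := coefs v x y vV vE.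
by exists x, y.
Qed.

(** Each dyadic block of terms contributes at most 1; the term of index 0 is 0, as the inverse of
    0. *)
Lemma harmonic_dyadic (R : realFieldType) (t : nat) :
  \sum_(s < 2 ^ t) (s%:R : R)^-1 <= t%:R.
Proof.
rewrite -(big_mkord xpredT (fun s => (s%:R : R)^-1)).
elim: t => [|t IH]; first by rewrite expn0 big_nat1 invr0.
rewrite (@big_cat_nat _ _ _ (2 ^ t)) //=; last by rewrite leq_exp2l.
rewrite -[t.+1]addn1 natrD; apply: lerD => //.
have p0 : 0 < (2 ^ t)%:R :> R by rewrite ltr0n expn_gt0.
apply: le_trans (_ : \sum_(2 ^ t <= s < 2 ^ (t + 1)) ((2 ^ t)%:R : R)^-1 <= _).
  rewrite big_nat [leRHS]big_nat; apply: ler_sum => s /andP[hs _].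
  by rewrite lef_pV2 ?posrE ?ler_nat // ltr0n (leq_trans _ hs) // expn_gt0.
rewrite sumr_const_nat addn1 expnS mul2n -addnn addnK -[_ *+ _]mulr_natl.
by rewrite divff ?gt_eqF.
Qed.

(** By injectivity each code stands for at most one [x]. The values in [Z] are integer vectors in
    the application, so [Z] is not assumed finite. *)
Lemma card_le_decoding (X Y : finType) (Z : eqType) (iota : X -> Z) (dec : Y -> Z) :
  injective iota -> (#|[set x | [exists y, iota x == dec y]]| <= #|Y|)%N.
Proof.
move=> inj; set S := finset _.
have -> : #|S| = #|Some @: S| by rewrite card_imset //; exact: Some_inj.
apply: leq_trans (_ : #|(fun y => [pick x | iota x == dec y]) @: [set: Y]| <= _)%N;
  last by rewrite -cardsT leq_imset_card.
apply/subset_leq_card/fintype.subsetP => _ /imsetP[x + ->].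
rewrite inE => /existsP[y /eqP xy]; apply/imsetP; exists y; rewrite ?inE //.
case: pickP => [x' /eqP|/(_ x)]; last by rewrite xy eqxx.
by rewrite -xy => /inj ->.
Qed.

Definition diff (m : nat) (p q : 'rV['I_m]_3) : 'rV[int]_3 :=
  \row_j ((p 0 j : nat)%:Z - (q 0 j : nat)%:Z).

(* Degenerate quadruples count as coplanar. Hence [plane_size] is maximal on
   collinear triples and [pencil_size] on equal pairs, which is how overlaps and
   collisions are excluded. *)
Definition coplanar (m : nat) (a b c d : 'rV['I_m]_3) : bool :=
  det3 (diff b a) (diff c a) (diff d a) == 0.

Lemma diff_inj m (a : 'rV['I_m]_3) : injective (fun p => diff p a).
Proof.
move=> p q /rowP h; apply/rowP => j; have := h j; rewrite !mxE => /addIr [] hj.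
exact: val_inj.
Qed.

Lemma sup_norm_diff m (p q : 'rV['I_m]_3) : (sup_norm (diff p q) <= m)%N.
Proof.
apply/bigop.bigmax_leqP => j _; rewrite mxE.
have := ltn_ord (p 0 j); have := ltn_ord (q 0 j); lia.
Qed.

(** * Codes for triples of dependent vectors *)

Section Codes.
Variables (m s1 s2 : nat).

Definition coef_code : finType :=
  ('I_(2 * (3 * m %/ s1)).+1 * 'I_(2 * (4 * m %/ s2)).+1)%type.

(* The first factor is empty unless [0 < s1 <= s2 <= 4 m]; then come the signs of
   the two extremal entries, and the four other entries of the reduced pair. *)
Definition pair_code : finType :=
  (('I_[&& 0 < s1, s1 <= s2 & s2 <= 4 * m]%N * (bool * bool)) *
   (('I_(2 * s1).+1 * 'I_(2 * s1).+1) * ('I_(2 * s1).+1 * 'I_(2 * s2).+1)))%type.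

Definition triple_code : finType :=
  (pair_code * (coef_code * coef_code * coef_code))%type.

Definition signed (b : bool) (s : nat) : int := (-1) ^+ b * s%:Z.

Definition centered (k : nat) (x : 'I_(2 * k).+1) : int := (x : nat)%:Z - k%:Z.

Lemma signed_absz (z : int) : exists b, z = signed b (absz z).
Proof. by exists (z < 0); exact: intEsign. Qed.

Lemma centered_surj (k : nat) (z : int) : (absz z <= k)%N ->
  exists x, z = @centered k x.
Proof.
move=> h; have zk : (absz (z + k%:Z)%R < (2 * k).+1)%N by lia.
by exists (Ordinal zk); rewrite /centered /=; lia.
Qed.

Definition decode_pair (i j : 'I_3) (c : pair_code) : 'rV[int]_3 * 'rV[int]_3 :=
  let: ((_, (b1, b2)), ((x1, x2), (y1, y2))) := c in
  (\row_k (if k == i then signed b1 s1 else if k == j then centered x1 else centered x2),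
   \row_k (if k == j then signed b2 s2 else if k == i then centered y1 else centered y2)).

Definition decode_comb (e1 e2 : 'rV[int]_3) (c : coef_code) : 'rV[int]_3 :=
  centered c.1 *: e1 + centered c.2 *: e2.

Definition decode_triple (i j : 'I_3) (c : triple_code) :
    'rV[int]_3 * 'rV[int]_3 * 'rV[int]_3 :=
  let: (e1, e2) := decode_pair i j c.1 in
  (decode_comb e1 e2 c.2.1.1, decode_comb e1 e2 c.2.1.2, decode_comb e1 e2 c.2.2).

Lemma ord3_third (i j k l : 'I_3) :
  i != j -> k != i -> k != j -> l != i -> l != j -> k = l.
Proof.
by move: i j k l; do 4![case=> [[|[|[|?]]] ?] //]; move=> *; apply: val_inj.
Qed.

Lemma decode_pair_surj (e1 e2 : 'rV[int]_3) i j : reduced_pair m e1 e2 i j ->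
  sup_norm e1 = s1 -> sup_norm e2 = s2 -> exists c, decode_pair i j c = (e1, e2).
Proof.
move=> [ij e1i e2j e2i [p1 p12 p2]] E1 E2.
have c0 : (0 < [&& 0 < s1, s1 <= s2 & s2 <= 4 * m])%N by rewrite -E1 -E2 p1 p12 p2.
have [l li lj] : exists2 l : 'I_3, l != i & l != j.
  have : (0 < #|~: [set i; j]|)%N by rewrite cardsCs finset.setCK cards2 card_ord; case: eqP.
  by case/card_gt0P => l; rewrite !inE negb_or => /andP[]; exists l.
have [b1 B1] := signed_absz (e1 0 i); have [b2 B2] := signed_absz (e2 0 j).
have h1 k : (absz (e1 0%R k) <= s1)%N by rewrite -E1 sup_norm_ge.
have h2 k : (absz (e2 0%R k) <= s2)%N by rewrite -E2 sup_norm_ge.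
have [x1 X1] := centered_surj (h1 j); have [x2 X2] := centered_surj (h1 l).
have e2i' : (absz (e2 0%R i) <= s1)%N by rewrite -E1.
have [y1 Y1] := centered_surj e2i'; have [y2 Y2] := centered_surj (h2 l).
exists ((Ordinal c0, (b1, b2)), ((x1, x2), (y1, y2))).
rewrite /decode_pair; congr (_, _); apply/rowP => k; rewrite mxE.
  case: (eqVneq k i) => [->|ki]; first by rewrite B1 e1i E1.
  case: (eqVneq k j) => [->|kj]; first by rewrite -X1.
  by rewrite (ord3_third ij ki kj li lj) -X2.
case: (eqVneq k j) => [->|kj]; first by rewrite B2 e2j E2.
case: (eqVneq k i) => [->|ki]; first by rewrite -Y1.
by rewrite (ord3_third ij ki kj li lj) -Y2.
Qed.

Lemma decode_comb_surj (e1 e2 v : 'rV[int]_3) : (0 < s1)%N -> (0 < s2)%N ->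
  sup_norm e1 = s1 -> sup_norm e2 = s2 -> bounded_comb m e1 e2 v ->
  exists c, decode_comb e1 e2 c = v.
Proof.
move=> p1 p2 E1 E2 [x [y [-> hx hy]]]; rewrite E1 in hx; rewrite E2 in hy.
rewrite -leq_divRL // in hx; rewrite -leq_divRL // in hy.
have [x' ->] := centered_surj hx; have [y' ->] := centered_surj hy.
by exists (x', y').
Qed.

(** There are [O(s1^3 s2)] pairs and [O(m^2 / (s1 s2))] choices of coefficients for each of three
    vectors, so [s1] cancels. The constants are [324 = 4 * 3^4] and [120 = 10 * 12]. *)
Lemma card_triple_code (R : realFieldType) :
  #|triple_code|%:R <= (0 < s1 <= s2)%:R * (324%:R * 120%:R ^+ 3 * m%:R ^+ 6 / s2%:R ^+ 2) :> R.
Proof.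
rewrite !card_prod !card_ord card_bool.
case: (boolP [&& 0 < s1, s1 <= s2 & s2 <= 4 * m]%N) => [/and3P[p1 p12 p2]|_]; last first.
  rewrite !mul0n; apply: mulr_ge0; first by rewrite ler0n.
  by rewrite divr_ge0 ?mulr_ge0 ?exprn_ge0 ?ler0n.
rewrite p1 p12 !mul1r mul1n.
have s2p : (0 < s2)%N by exact: leq_trans p12.
have r1 : 0 < s1%:R :> R by rewrite ltr0n.
have r2 : 0 < s2%:R :> R by rewrite ltr0n.
have a1 : ((2 * s1).+1%:R : R) <= 3 * s1%:R by rewrite -natrM ler_nat; lia.
have a2 : ((2 * s2).+1%:R : R) <= 3 * s2%:R by rewrite -natrM ler_nat; lia.
(* Since [s1] and [s2] are at most [4 m], the extra 1 costs at most [4 m / s1] or [4 m / s2]. *)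
have b1 : ((2 * (3 * m %/ s1)).+1%:R : R) <= 10 * m%:R / s1%:R.
  rewrite ler_pdivlMr // -!natrM ler_nat.
  by have := leq_trunc_div (3 * m) s1; lia.
have b2 : ((2 * (4 * m %/ s2)).+1%:R : R) <= 12 * m%:R / s2%:R.
  rewrite ler_pdivlMr // -!natrM ler_nat.
  by have := leq_trunc_div (4 * m) s2; lia.
rewrite !natrM.
set A1 : R := (2 * s1).+1%:R in a1 *; set A2 : R := (2 * s2).+1%:R in a2 *.
set B1 : R := (2 * (3 * m %/ s1)).+1%:R in b1 *.
set B2 : R := (2 * (4 * m %/ s2)).+1%:R in b2 *.
have A10 : 0 <= A1 by rewrite ler0n.
have A20 : 0 <= A2 by rewrite ler0n.
have B10 : 0 <= B1 by rewrite ler0n.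
have B20 : 0 <= B2 by rewrite ler0n.
apply: le_trans (_ : 4 * (A1 ^+ 3 * A2) * (B1 * B2) ^+ 3 <= _).
  by rewrite le_eqVlt; apply/orP; left; apply/eqP; ring.
apply: le_trans (_ : 4 * ((3 * s1%:R) ^+ 3 * (3 * s2%:R))
    * ((10 * m%:R / s1%:R) * (12 * m%:R / s2%:R)) ^+ 3 <= _).
  apply: ler_pM; rewrite ?mulr_ge0 ?exprn_ge0 ?mulr_ge0 //.
    rewrite ler_pM2l //; apply: ler_pM; rewrite ?exprn_ge0 //.
    by rewrite lerXn2r // nnegrE ?mulr_ge0 ?ler0n.
  rewrite lerXn2r // ?nnegrE ?mulr_ge0 // ?invr_ge0 ?ler0n //.
  by apply: ler_pM.
by rewrite le_eqVlt; apply/orP; left; apply/eqP; field; rewrite !gt_eqF.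
Qed.

End Codes.

(** * Summing the codes over all norms *)

Lemma ler_term_sum (R : realFieldType) (I : finType) (F : I -> R) i :
  (forall i, 0 <= F i) -> F i <= \sum_i F i.
Proof. by move=> F0; rewrite (bigD1 i) //= lerDl sumr_ge0. Qed.

Lemma count_ord_le (B k : nat) : (\sum_(s < B) (0 < s <= k) <= k)%N.
Proof.
suff : (\sum_(s < B) (0 < s <= k) <= minn B.-1 k)%N by lia.
elim: B => [|B IH]; first by rewrite big_ord0.
rewrite big_ord_recr /=; apply: leq_trans (leq_add IH (leqnn _)) _.
by case: (ltnP 0 B) => hB; case: (leqP B k) => hk /=; lia.
Qed.

(** Each of the nine pairs [(i, j)] contributes, for fixed [s2], at most [s2] values of [s1] with
    [O(m^6 / s2^2)] codes each; the resulting sum of [m^6 / s2] is harmonic. The condition on [t]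
    puts all norms below [2 ^ t]. *)
Lemma sum_coplanar_le (R : realFieldType) (m t : nat) (a : 'rV['I_m]_3) :
  (0 < m)%N -> (4 * m < 2 ^ t)%N ->
  \sum_b \sum_c \sum_d (coplanar a b c d)%:R
    <= 9%:R * (324%:R * 120%:R ^+ 3) * m%:R ^+ 6 * t%:R :> R.
Proof.
move=> m0 mt; set K : R := 324%:R * 120%:R ^+ 3.
pose P := 'rV['I_m]_3.
pose iota (x : P * P * P) := (diff x.1.1 a, diff x.1.2 a, diff x.2 a).
have inj : injective iota.
  by move=> [[b c] d] [[b' c'] d'] [/diff_inj -> /diff_inj -> /diff_inj ->].
pose S (i j : 'I_3) (s1 s2 : 'I_(2 ^ t)) :=
  [set x | [exists y : triple_code m s1 s2, iota x == decode_triple i j y]].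
have cover x : coplanar a x.1.1 x.1.2 x.2 ->
    exists i j s1 s2, x \in S i j s1 s2.
  move=> /eqP; set V := [:: diff x.1.1 a; diff x.1.2 a; diff x.2 a].
  move=> /det3_eq0_rank2[f1 [f2 Vf]].
  have Vm : {in V, forall v, (sup_norm v <= m)%N}.
    by move=> v; rewrite !inE => /or3P[] /eqP ->; exact: sup_norm_diff.
  have [e1 [e2 [i [j [red com]]]]] := rank2_reduced_pair m0 Vm Vf.
  have [_ _ _ _ [p1 p12 p2]] := red.
  have h2 : (sup_norm e2 < 2 ^ t)%N by exact: leq_ltn_trans mt.
  have h1 : (sup_norm e1 < 2 ^ t)%N by exact: leq_ltn_trans h2.
  exists i, j, (Ordinal h1), (Ordinal h2); rewrite inE.
  have [c0 C0] := decode_pair_surj red erefl erefl.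
  have p2' : (0 < sup_norm e2)%N by exact: leq_trans p12.
  have cc v (vV : v \in V) := decode_comb_surj p1 p2' erefl erefl (com v vV).
  have [c1 C1] := cc (diff x.1.1 a) (mem_head _ _).
  have [c2 C2] : exists c, decode_comb (s1 := sup_norm e1) (s2 := sup_norm e2) (m := m) e1 e2 c = diff x.1.2 a.
    by apply: cc; rewrite !inE eqxx orbT.
  have [c3 C3] : exists c, decode_comb (s1 := sup_norm e1) (s2 := sup_norm e2) (m := m) e1 e2 c = diff x.2 a.
    by apply: cc; rewrite !inE eqxx !orbT.
  apply/existsP; exists (c0, (c1, c2, c3)).
  by rewrite /decode_triple /= C0 C1 C2 C3.
have -> : \sum_b \sum_c \sum_d (coplanar a b c d)%:R =
    \sum_(x : P * P * P) (coplanar a x.1.1 x.1.2 x.2)%:R :> R.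
  by rewrite pair_bigA /= pair_bigA.
apply: le_trans (_ : \sum_x \sum_i \sum_j \sum_s2 \sum_s1 (x \in S i j s1 s2)%:R <= _).
  apply: ler_sum => x _.
  have ge0 : forall i j s1 s2, 0 <= (x \in S i j s1 s2)%:R :> R by move=> *; rewrite ler0n.
  case: (boolP (coplanar _ _ _ _)) => [/cover[i [j [s1 [s2 xS]]]]|_]; last first.
    by do 4!apply: sumr_ge0 => ? _.
  pose g i j s2 s1 : R := (x \in S i j s1 s2)%:R.
  have <- : g i j s2 s1 = true%:R by rewrite /g xS.
  apply: le_trans (ler_term_sum (F := g i j s2) s1 _) _ => //.
  apply: le_trans (ler_term_sum (F := fun s2 => \sum_s1 g i j s2 s1) s2 _) _.
    by move=> *; apply: sumr_ge0.
  apply: le_trans (ler_term_sum (F := fun j => \sum_s2 \sum_s1 g i j s2 s1) j _) _.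
    by move=> *; do 2!apply: sumr_ge0 => ? _.
  apply: le_trans (ler_term_sum (F := fun i => \sum_j \sum_s2 \sum_s1 g i j s2 s1) i _) _ => //.
  by move=> *; do 3!apply: sumr_ge0 => ? _.
rewrite exchange_big /=.
have bound i j : \sum_x \sum_s2 \sum_s1 (x \in S i j s1 s2)%:R <= K * m%:R ^+ 6 * t%:R :> R.
  rewrite exchange_big /=.
  apply: le_trans (_ : \sum_(s2 < 2 ^ t) K * m%:R ^+ 6 * (s2%:R)^-1 <= _); last first.
    rewrite -mulr_sumr ler_wpM2l ?harmonic_dyadic //.
    by rewrite mulr_ge0 ?exprn_ge0 ?mulr_ge0 ?ler0n.
  apply: ler_sum => s2 _; rewrite exchange_big /=.
  apply: le_trans (_ : \sum_(s1 < 2 ^ t) (0 < s1 <= s2)%:R * (K * m%:R ^+ 6 / s2%:R ^+ 2) <= _).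
    apply: ler_sum => s1 _.
    have -> : \sum_x (x \in S i j s1 s2)%:R = #|S i j s1 s2|%:R :> R.
      rewrite -sum1_card natr_sum [RHS]big_mkcond; apply: eq_bigr => x _.
      by case: (x \in _).
    apply: le_trans (card_triple_code m s1 s2 R).
    by rewrite ler_nat; exact: card_le_decoding.
  rewrite -mulr_suml.
  have [->|s2n0] := eqVneq (s2%:R : R) 0; first by rewrite expr0n invr0 !mulr0.
  have -> : K * m%:R ^+ 6 / s2%:R = s2%:R * (K * m%:R ^+ 6 / s2%:R ^+ 2) :> R.
    by field.
  rewrite ler_wpM2r //; first by rewrite divr_ge0 ?mulr_ge0 ?exprn_ge0 ?ler0n.
  by rewrite -natr_sum ler_nat count_ord_le.
apply: le_trans (_ : \sum_(i < 3) \sum_(j < 3) K * m%:R ^+ 6 * t%:R <= _).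
  by apply: ler_sum => i _; rewrite exchange_big /=; apply: ler_sum => j _.
rewrite !sumr_const !card_ord -mulrnA -[_ *+ _]mulr_natl !mulrA.
exact: lexx.
Qed.

(** * Drawings from placements *)

(** Transposing two of the four points negates the determinant; the same holds for the next two
    lemmas. *)
Lemma coplanar12 m (a b c d : 'rV['I_m]_3) : coplanar b a c d = coplanar a b c d.
Proof.
rewrite /coplanar -[RHS]oppr_eq0; congr (_ == 0).
by rewrite /det3 !mxE; ring.
Qed.

Lemma coplanar23 m (a b c d : 'rV['I_m]_3) : coplanar a c b d = coplanar a b c d.
Proof.
rewrite /coplanar -[RHS]oppr_eq0; congr (_ == 0).
by rewrite /det3 !mxE; ring.
Qed.

Lemma coplanar34 m (a b c d : 'rV['I_m]_3) : coplanar a b d c = coplanar a b c d.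
Proof.
rewrite /coplanar -[RHS]oppr_eq0; congr (_ == 0).
by rewrite /det3 !mxE; ring.
Qed.

Section Drawing.
Variables (R : realType) (m : nat).
Implicit Types a b c d : 'rV['I_m]_3.
Local Notation q := (@grid_point R m).

Lemma coplanarE a b c d :
  coplanar a b c d = (det3 (q b - q a) (q c - q a) (q d - q a) == 0).
Proof.
have E (x y : 'rV['I_m]_3) j : (q x - q y) 0 j = (diff x y 0 j)%:~R.
  by rewrite !mxE rmorphB.
rewrite /coplanar /det3 !E -!(rmorphM, rmorphB, rmorphD) /= intr_eq0.
by [].
Qed.

Lemma det3_comb (u v : 'rV[R]_3) x y : det3 u v (x *: u + y *: v) = 0.
Proof. by rewrite /det3 !mxE; ring. Qed.

Lemma coplanar_comb a b c d x y :
  q d - q a = x *: (q b - q a) + y *: (q c - q a) -> coplanar a b c d.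
Proof. by move=> h; rewrite coplanarE h det3_comb. Qed.

Lemma coplanar_collinear a b c d x : q c - q a = x *: (q b - q a) -> coplanar a b c d.
Proof.
by move=> h; rewrite -coplanar34; apply: (@coplanar_comb _ _ _ _ x 0); rewrite scale0r addr0.
Qed.

Lemma plane_size_full a b c : (forall d, coplanar a b c d) ->
  plane_size R (@coplanar m) a b c = #|'rV['I_m]_3|%:R.
Proof.
move=> h; rewrite /plane_size; under eq_bigr do rewrite h.
by rewrite sumr_const.
Qed.

Lemma pencil_size_full a b : (forall c d, coplanar a b c d) ->
  pencil_size R (@coplanar m) a b = #|'rV['I_m]_3|%:R ^+ 2.
Proof.
move=> h; rewrite /pencil_size.
under eq_bigr => c _ do rewrite plane_size_full //.
by rewrite sumr_const -[_ *+ _]mulr_natl.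
Qed.

Lemma open_segmentC (x y : 'rV[R]_3) z : open_segment x y z -> open_segment y x z.
Proof.
move=> [t]; rewrite /= in_itv /= => /andP[t0 t1] <-; exists (1 - t).
  by rewrite /= in_itv /=; apply/andP; split; lra.
by rewrite subKr addrC.
Qed.

Lemma open_segments_collinear a b c :
  (exists z, open_segment (q c) (q a) z /\ open_segment (q c) (q b) z) ->
  forall d, coplanar b c a d.
Proof.
move=> [z [[t + <-] [s + E]]] d; rewrite /= !in_itv /= => /andP[t0 _] /andP[s0 _].
(* The common point is [c + t (a - c) = c + s (b - c)] with [t] nonzero. *)
rewrite -coplanar12; apply: (@coplanar_collinear _ _ _ _ (s / t)).
apply/rowP => j; move/rowP: E => /(_ j); rewrite !mxE => E.
have tn0 : t != 0 by rewrite gt_eqF.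
apply: (mulfI tn0); rewrite [RHS]mulrA [t * (_ / _)]mulrCA divff // mulr1.
move: (_%:R) (_%:R) (_%:R) E => A B C' E; lra.
Qed.

Lemma open_segments_coplanar u v x y :
  (exists z, open_segment (q u) (q v) z /\ open_segment (q x) (q y) z) ->
  coplanar u x y v.
Proof.
move=> [z [[t + <-] [s + E]]]; rewrite /= !in_itv /= => /andP[t0 _] /andP[s0 _].
have tn0 : t != 0 by rewrite gt_eqF.
(* Solve [u + t (v - u) = u + (1 - s) (x - u) + s (y - u)] for [v - u]. *)
apply: (@coplanar_comb _ _ _ _ ((1 - s) / t) (s / t)).
apply/rowP => j; move/rowP: E => /(_ j); rewrite !mxE => E.
apply: (mulfI tn0); rewrite [RHS]mulrDr ![in RHS]mulrA ![t * _ / t]mulrAC divff // !mul1r.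
move: (_%:R) (_%:R) (_%:R) (_%:R) E => A B C' D' E; lra.
Qed.

Lemma segment_coplanar u v w : segment (q u) (q v) (q w) -> forall d, coplanar w u v d.
Proof.
move=> [t _ E] d.
have EE j : q w 0 j = (1 - t) * q u 0 j + t * q v 0 j by rewrite -E !mxE.
rewrite coplanarE /det3; apply/eqP.
do 3!rewrite [(q u - q w) _ _]mxE [(q v - q w) _ _]mxE.
rewrite ![(- q w) _ _]mxE !EE; ring.
Qed.

(** The conditions exclude, in order, crossings of disjoint edges; vertices on edges and overlaps of
    edges with a common endpoint; and coinciding vertices. *)
Theorem grid_drawing_of_placement (T : finType) (e : rel T) (p : T -> 'rV['I_m]_3) :
  symmetric e -> irreflexive e ->
  (forall u v x y, e u v -> e x y -> x != u -> x != v -> y != u -> y != v ->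
     ~~ coplanar (p u) (p x) (p y) (p v)) ->
  (forall u x y, e x y -> x != u -> y != u ->
     plane_size R (@coplanar m) (p u) (p x) (p y) < #|'rV['I_m]_3|%:R) ->
  (forall u x, u != x ->
     pencil_size R (@coplanar m) (p u) (p x) < #|'rV['I_m]_3|%:R ^+ 2) ->
  grid_drawing R e p.
Proof.
move=> es ei h4 h3 h2; split.
- move=> u x pux; apply/eqP; apply: contraT => /h2.
  rewrite pencil_size_full ?ltxx // => c d; rewrite pux.
  by rewrite -coplanar23 -coplanar34; apply: (@coplanar_comb _ _ _ _ 0 0); rewrite subrr scale0r !scale0r addr0.
- move=> u v w uv; rewrite !inE negb_or => /andP[wu wv] /segment_coplanar h.
  have := h3 w u v uv; rewrite plane_size_full // ltxx.
  by rewrite eq_sym wu eq_sym wv => /(_ isT isT).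
have shared (c a b : T) : e c a -> e c b -> a != b ->
    ~ exists z, open_segment (q (p c)) (q (p a)) z /\ open_segment (q (p c)) (q (p b)) z.
  move=> ca cb ab /open_segments_collinear h.
  have := h3 b c a ca; rewrite plane_size_full // ltxx ab.
  have -> : c != b by apply: contraTneq cb => ->; rewrite ei.
  by move=> /(_ isT isT).
move=> u v w x uv wx nuv [z [z1 z2]].
have [wu|wu] := eqVneq w u.
  subst w; apply: (shared u v x uv wx _ (ex_intro _ z (conj z1 z2))).
  by apply: contraNneq nuv => ->.
have [wv|wv] := eqVneq w v.
  subst w; apply: (shared v u x _ wx _ (ex_intro _ z (conj (open_segmentC z1) z2))).
    by rewrite es.
  by apply: contraNneq nuv => ->; rewrite finset.setUC.
have [xu|xu] := eqVneq x u.
  subst x; apply: (shared u v w uv _ _ (ex_intro _ z (conj z1 (open_segmentC z2)))).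
    by rewrite es.
  by rewrite eq_sym.
have [xv|xv] := eqVneq x v.
  subst x; apply: (shared v u w _ _ _ (ex_intro _ z (conj (open_segmentC z1) (open_segmentC z2)))).
  - by rewrite es.
  - by rewrite es.
  by rewrite eq_sym.
apply/negP: (h4 u v w x uv wx wu wv xu xv).
by rewrite negbK; apply: open_segments_coplanar; exists z.
Qed.

End Drawing.

(** * Degeneracy and edge counts *)

Lemma low_degree_vertex (T : finType) (e : rel T) (D : nat) :
  symmetric e -> irreflexive e -> degenerate D e ->
  forall S : {set T}, S != finset.set0 ->
    exists2 x, x \in S & (#|[set y in S | e x y]| <= minn D #|T|)%N.
Proof.
move=> es ei; rewrite /degenerate /degeneracy; case: ex_minnP => d /andP[_ low] _ dD S S0.
pose F := [set f in edge_set e | f \subset S].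
have sF : subgraph e S F.
  apply/andP; split; first by apply/fintype.subsetP => f; rewrite inE => /andP[].
  by apply/forall_inP => f; rewrite inE => /andP[].
have /existsP[x /andP[xS dx]] : [exists x in S, (degree_in F x <= d)%N].
  by move/forallP/(_ S)/forallP/(_ F)/implyP: low; apply; rewrite S0 sF.
(* The minimum with [#|T|] later keeps the logarithm of the grid size [O(log n)] however large [D]
   is. *)
exists x => //; rewrite leq_min max_card andbT.
apply: leq_trans dD; apply: leq_trans dx.
have inj : {in [set y in S | e x y] &, injective (fun y => [set x; y])}.
  move=> y z; rewrite !inE => /andP[_ xy] /andP[_ xz] /setP/(_ y).
  rewrite !inE eqxx orbT => /esym/orP[/eqP yx|/eqP //].
  by rewrite yx ei in xy.
rewrite -(card_in_imset inj); apply/subset_leq_card/fintype.subsetP => _ /imsetP[y + ->].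
rewrite !inE eqxx /= andbT => /andP[yS xy]; apply/andP; split.
  by apply/imsetP; exists (x, y); rewrite ?inE.
by apply/fintype.subsetP => z; rewrite !inE => /orP[] /eqP ->.
Qed.

Lemma sum_adjacency (R : realFieldType) (T : finType) (e : rel T) :
  \sum_u \sum_v (e u v)%:R = #|[set p : T * T | e p.1 p.2]|%:R :> R.
Proof.
rewrite pair_bigA /= -sum1_card natr_sum [RHS]big_mkcond; apply: eq_bigr => p _.
by rewrite inE; case: (e _ _).
Qed.

Lemma edge_set_imset (T : finType) (e : rel T) :
  edge_set e = (fun p : T * T => [set p.1; p.2]) @: [set p : T * T | e p.1 p.2].
Proof.
by apply/setP => f; apply/imsetP/imsetP => -[p pe ->]; exists p => //; rewrite inE in pe *.
Qed.

Lemma card_edge_set_le (T : finType) (e : rel T) :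
  (#|edge_set e| <= #|[set p : T * T | e p.1 p.2]|)%N.
Proof. by rewrite edge_set_imset leq_imset_card. Qed.

Lemma card_adjacency_le (T : finType) (e : rel T) :
  (#|[set p : T * T | e p.1 p.2]| <= 2 * #|edge_set e|)%N.
Proof.
rewrite edge_set_imset -sum1_card.
rewrite (partition_big_imset (fun p : T * T => [set p.1; p.2])) /= mulnC -sum_nat_const.
apply: leq_sum => _ /imsetP[[x y] _ ->] /=.
rewrite sum1_card; apply: leq_trans (_ : #|[set (x, y); (y, x)]| <= _)%N; last first.
  by rewrite cards2; case: (_ == _).
apply/subset_leq_card/fintype.subsetP => -[a b]; rewrite !inE /= => /andP[_ /eqP/setP E].
have := E x; have := E y; have := E a; have := E b.
rewrite !inE !eqxx ?orbT /= !xpair_eqE.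
by do 4![case: eqVneq => [?|?]; subst; rewrite ?eqxx //=].
Qed.

(** * Choice of the grid size *)

Lemma exp_dominates_linear (j : nat) : exists k, (j * (k + 7) <= 2 ^ k)%N.
Proof.
exists (2 * j + 8)%N.
have -> : (2 * j + 8 = (j + 4) + (j + 4))%N by lia.
rewrite expnD; apply: leq_mul; first by have := ltn_expl (j + 4) (isT : (1 < 2)%N); lia.
by rewrite expnD; have := ltn_expl j (isT : (1 < 2)%N); lia.
Qed.

(** The grid side will be [2 ^ q]. Rounding [X] up to a power of 2 costs a factor 2, and rounding
    the exponent up to a multiple of 3 another 4. As [X] is at most [2 ^ k] times a polynomial in
    [n], [q] is [O(log n)]. *)
Lemma grid_exponent (k n D E : nat) : (2 <= n)%N -> (0 < D <= n)%N -> (0 < E <= n * n)%N ->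
  let l := up_log 2 n in let X := (2 ^ k * D * E * l)%N in
  exists q, [/\ (X <= 2 ^ (3 * q))%N, (2 ^ (3 * q) <= 8 * X)%N
    & (q + 3 <= (k + 7) * l)%N].
Proof.
move=> n2 /andP[D0 Dn] /andP[E0 En] l X.
have l0 : (0 < l)%N by rewrite /l up_log_gt0.
have nl : (n <= 2 ^ l)%N by rewrite /l up_logP.
have k0 : (0 < 2 ^ k)%N by rewrite expn_gt0.
have X0 : (0 < X)%N by rewrite !muln_gt0 k0 D0 E0 l0.
have ll : (l <= 2 ^ l)%N by apply/ltnW/ltn_expl.
have XU : (X <= 2 ^ (k + 4 * l))%N.
  have -> : (2 ^ (k + 4 * l) = 2 ^ k * 2 ^ l * (2 ^ l * 2 ^ l) * 2 ^ l)%N.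
    by rewrite -!expnD; congr (_ ^ _)%N; lia.
  rewrite /X; do 3?[apply: leq_mul] => //.
    exact: leq_trans nl.
  by apply: leq_trans En _; apply: leq_mul.
set u := up_log 2 X.
have Xu : (X <= 2 ^ u)%N by rewrite /u up_logP.
have uX : (2 ^ u <= 2 * X)%N.
  have [u0|u0] := posnP u; first by rewrite u0 expn0; lia.
  have X1 : (1 < X)%N by move: u0; rewrite up_log_gt0.
  have /ltnW h := up_log_gtn (isT : (1 < 2)%N) X1.
  by rewrite -(prednK u0) expnS leq_mul2l.
have uk : (u <= k + 4 * l)%N by rewrite /u up_log_min.
exists ((u + 2) %/ 3)%N; split.
- by apply: leq_trans Xu _; rewrite leq_exp2l //; lia.
- apply: leq_trans (_ : 2 ^ (u + 2) <= _)%N; first by rewrite leq_exp2l //; lia.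
  by rewrite expnD; lia.
nia.
Qed.

(** Rounding up adds at most 1 to the binary logarithm, which is itself at least 1. *)
Lemma up_log2_le_ln (R : realType) (n : nat) : (2 <= n)%N ->
  (up_log 2 n)%:R <= 2 / ln 2 * ln n%:R :> R.
Proof.
move=> n2; have l2 : 0 < ln 2 :> R by rewrite ln_gt0 // ltr1n.
rewrite mulrAC ler_pdivlMr //.
have n0 : (0 < n)%N by apply: leq_trans n2.
have l0 : (0 < up_log 2 n)%N by rewrite up_log_gt0.
have h : (2 ^ (up_log 2 n).-1 <= n)%N.
  exact: ltnW (up_log_gtn _ n2).
have h1 : (up_log 2 n).-1%:R * ln 2 <= ln n%:R :> R.
  rewrite mulr_natl -lnXn // ler_ln ?posrE ?exprn_gt0 ?ltr0n //.
  by rewrite -natrX ler_nat.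
have h2 : ln 2 <= ln n%:R :> R by rewrite ler_ln ?posrE ?ltr0n // ler_nat.
rewrite -(prednK l0) -natr1; lra.
Qed.

Theorem theorem1p1 (R : realType) :
  exists C : R, 0 < C /\
    forall (D : nat) (T : finType) (e : rel T),
      (1 <= D)%N -> symmetric e -> irreflexive e -> degenerate D e ->
      (2 <= #|T|)%N -> (#|T| <= #|edge_set e|)%N ->
      exists m : nat,
        [/\ (0 < m)%N,
            (m ^ 3)%:R <= C * D%:R * #|edge_set e|%:R * ln (#|T|%:R : R)
          & exists p : T -> 'rV['I_m]_3, grid_drawing R e p].
Proof.
pose K0 : R := 9%:R * (324%:R * 120%:R ^+ 3).
have K00 : 0 < K0 by rewrite !mulr_gt0 ?exprn_gt0 ?ltr0n.
(* With [N = K0 m^6 (q + 3)], the size condition of [exists_placement] reduces to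
   [c D E (q + 3) <= m ^ 3]; the factor 2 turns edges into ordered pairs. *)
pose c : R := 2 * 32%:R ^+ 3 * K0.
have c0 : 0 <= c by rewrite !mulr_ge0 ?exprn_ge0 ?ler0n.
have [j cj] : exists j : nat, c <= j%:R.
  by exists (Num.bound c); exact/ltW/archi_boundP.
(* The grid must beat a multiple of its own logarithm, which [grid_exponent] bounds by
   [(k + 7) * l]; so [2 ^ k] is chosen to dominate [j * (k + 7)]. *)
have [k kj] := exp_dominates_linear j.
have l2 : 0 < ln 2 :> R by rewrite ln_gt0 // ltr1n.
(* The factor 8 is the rounding of [X], and [2 / ln 2] converts [up_log 2 n] into [ln n]. *)
exists (8 * 2 ^+ k * (2 / ln 2)); split; first by rewrite mulr_gt0 ?divr_gt0 // mulr_gt0 ?exprn_gt0.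
move=> D T e D1 es ei deg n2 nk.
set n := #|T|; set E := #|edge_set e|; pose D0 := minn D n.
have n0 : (0 < n)%N by apply: leq_trans n2.
have D00 : (0 < D0)%N by rewrite leq_min D1.
have EE : (E <= n * n)%N.
  apply: leq_trans (card_edge_set_le e) _; rewrite -card_prod; exact: max_card.
have E0 : (0 < E)%N by exact: leq_trans nk.
have hD : (0 < D0 <= n)%N by rewrite D00 geq_minr.
have hE : (0 < E <= n * n)%N by rewrite E0.
have [q [Xq qX ql]] := grid_exponent k n2 hD hE.
set l := up_log 2 n in Xq qX ql; set X := (2 ^ k * D0 * E * l)%N in Xq qX.
pose m := (2 ^ q)%N.
have m0 : (0 < m)%N by rewrite expn_gt0.
have m3 : (m ^ 3 = 2 ^ (3 * q))%N by rewrite -expnM mulnC.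
exists m; split=> //.
  apply: le_trans (_ : 8 * (2 ^+ k * D0%:R * E%:R * l%:R) <= _).
    by rewrite -natrX -!natrM ler_nat m3.
  have hl := up_log2_le_ln R n2; rewrite -/n -/l in hl.
  have hD0 : D0%:R <= D%:R :> R by rewrite ler_nat geq_minl.
  have -> : 8 * 2 ^+ k * (2 / ln 2) * D%:R * E%:R * ln n%:R =
    8 * (2 ^+ k * D%:R * E%:R * (2 / ln 2 * ln n%:R)) :> R by ring.
  rewrite ler_pM2l //; apply: ler_pM; rewrite ?mulr_ge0 ?exprn_ge0 ?ler0n //.
  by rewrite ler_pM2r ?ltr0n // ler_pM2l // exprn_gt0.
have card_grid : #|'rV['I_m]_3| = (m ^ 3)%N by rewrite card_mx card_ord mul1n.
have mt : (4 * m < 2 ^ (q + 3))%N by rewrite addnC expnD ltn_pmul2r.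
pose N : R := K0 * m%:R ^+ 6 * (q + 3)%:R.
have mR : 0 < m%:R :> R by rewrite ltr0n.
have N0 : 0 < N.
  apply: mulr_gt0; last by rewrite ltr0n addnS.
  by apply: mulr_gt0 => //; exact: exprn_gt0.
have := @exists_placement R 'rV['I_m]_3 T (@coplanar m) e D0 N
  (@coplanar12 m) (@coplanar23 m) (@coplanar34 m) es ei D00
  (low_degree_vertex es ei deg).
case=> //.
- by move=> a; exact: sum_coplanar_le.
- by rewrite card_grid expn_gt0 m0.
- by rewrite sum_adjacency ler_nat; apply: leq_trans nk (card_edge_set_le e).
- rewrite sum_adjacency card_grid.
  apply: le_trans (_ : 32%:R ^+ 3 * D0%:R * (2 * E%:R) * N <= _).
    rewrite ler_pM2r // ler_pM2l ?mulr_gt0 ?exprn_gt0 ?ltr0n //.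
    by rewrite -natrM ler_nat card_adjacency_le.
  have -> : 32%:R ^+ 3 * D0%:R * (2 * E%:R) * N
      = c * (D0%:R * E%:R * (q + 3)%:R) * m%:R ^+ 6 :> R by rewrite /c /N; ring.
  have -> : (m ^ 3)%:R ^+ 3 = (m ^ 3)%:R * m%:R ^+ 6 :> R by rewrite natrX; ring.
  rewrite ler_pM2r ?exprn_gt0 //.
  apply: le_trans (_ : j%:R * (D0%:R * E%:R * ((k + 7) * l)%:R) <= _).
    apply: ler_pM => //.
    by rewrite ler_pM2l ?mulr_gt0 ?ltr0n // ler_nat.
  rewrite -!natrM ler_nat m3; apply: leq_trans Xq.
  have -> : (j * (D0 * E * ((k + 7) * l)) = j * (k + 7) * (D0 * E * l))%N by lia.
  have -> : X = (2 ^ k * (D0 * E * l))%N by rewrite /X !mulnA.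
  by rewrite leq_mul2r kj orbT.
move=> p [h4 h3 h2]; exists p.
exact: grid_drawing_of_placement.
Qed.
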